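(* Let $h:\mathbb{R}^n\to\mathbb{R}$ and $\mathcal{S}=\{x\in\mathbb{R}^n\mid h(x)\ge 0\}$. Assume: (i) $\mathcal{S}$ is nonempty and compact; (ii) $h$ is continuously differentiable and $\nabla h$ is locally Lipschitz, with Lipschitz constant $L_{\nabla h}$ on $\mathcal{S}$; (iii) $\nabla h(x)\neq 0$ for all $x\in\mathbb{R}^n$ with $h(x)=0$; (iv) there is $\gamma\in\mathcal{K}_\infty$ such that $d(x,\partial\mathcal{S})\le\gamma(h(x))$ for all $x\in\mathcal{S}$. Let $P\in\mathbb{R}^{n\times n}$ be symmetric positive definite, let $f:\mathbb{R}^m\times\mathbb{R}^n\to\mathbb{R}^n$ be locally Lipschitz, let $g:\mathbb{R}^m\times\mathbb{R}^n\to\mathbb{R}^m$, and let $\mathcal{Z}\subset\mathbb{R}^m$ be compact. Fix $\epsilon$ with $0<\epsilon<\min_{x\in\partial\mathcal{S}}\|\nabla h(x)\|$ and let $\alpha_*$ be the constant defined in the context. Let $\{\alpha_i\}_{i\in\mathbb{N}}$ be an increasing sequence of positive numbers with $\alpha_i\ge\alpha_*$ and $\lim_{i\to\infty}\alpha_i=\infty$. Let $(z_0,x_0)\in\mathcal{Z}\times\mathcal{S}$ and $T\in[0,\infty)$, and for each $i$ let $\phi_i:[0,T]\to\mathbb{R}^m\times\mathbb{R}^n$, with $\phi_i(0)=(z_0,x_0)$, be a solution of the CBF-based dynamics (see context) with $\alpha=\alpha_i$. Assume $\phi_i(t)\in\mathcal{Z}\times\mathcal{S}$ for all $t\in[0,T]$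 and all $i$. Then: 1. If $g$ is continuous and locally bounded, there is a subsequence $\{\phi_{i_k}\}_{k\in\mathbb{N}}$ of $\{\phi_i\}_{i\in\mathbb{N}}$ that converges uniformly, on any compact subinterval of $[0,T)$, to a solution $\phi:[0,T]\to\mathbb{R}^m\times\mathbb{R}^n$ of the PDS (see context) with $\phi(0)=(z_0,x_0)$. 2. If, further, $g$ is locally Lipschitz, then the whole sequence $\{\phi_i\}_{i\in\mathbb{N}}$ converges uniformly, on any compact subinterval of $[0,T)$, to the unique solution $\phi:[0,T]\to\mathbb{R}^m\times\mathbb{R}^n$ of the PDS with $\phi(0)=(z_0,x_0)$.
   Context: Notation: $\|\cdot\|$ is the Euclidean norm; $\|v\|_P=\sqrt{v^\top Pv}$; $d(x,A)=\min_{y\in A}\|x-y\|$ for closed $A$; $\partial\mathcal{S}$ is the topological boundary. $\mathcal{K}_\infty$ is the set of continuous strictly increasing $\gamma:[0,\infty)\to\mathbb{R}$ with $\gamma(0)=0$ and $\lim_{a\to\infty}\gamma(a)=+\infty$. $\mathcal{L}_fh(z,x):=\nabla h(x)^\top f(z,x)$. Tangent cone: for $x\in\mathcal{S}$, $T_{\mathcal{S}}(x)$ is the set of $w\in\mathbb{R}^n$ for which there exist $x_i\in\mathcal{S}$, $x_i\to x$, and $t_i>0$, $t_i\to0$, with $w=\lim_i (x_i-x)/t_i$. Under the assumptions, $T_{\mathcal{S}}(x)=\mathbb{R}^n$ for $x$ in the interior of $\mathcal{S}$ and $T_{\mathcal{S}}(x)=\{v\mid\nabla h(x)^\top v\ge0\}$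 for $x\in\partial\mathcal{S}$. PDS (projected dynamical system, interconnected form): $\dot\zeta=g(\zeta,\xi)$, $\ \dot\xi\in\operatorname{argmin}_{\mu\in T_{\mathcal{S}}(\xi)}\|\mu-f(\zeta,\xi)\|_P^2$, with state $(\zeta,\xi)\in\mathbb{R}^m\times\mathcal{S}$. CBF-based dynamics with parameter $\alpha>0$: $\dot\zeta=g(\zeta,\xi)$, $\ \dot\xi=f^P_{\mathrm{cbf},\alpha}(\zeta,\xi)$, where $f^P_{\mathrm{cbf},\alpha}(z,x)$ is the unique minimizer of $\|\mu-f(z,x)\|_P^2$ over $\mu\in\mathbb{R}^n$ subject to $\nabla h(x)^\top\mu+\alpha h(x)\ge0$; equivalently $$f^P_{\mathrm{cbf},\alpha}(z,x)=f(z,x)-\min\big(0,\mathcal{L}_fh(z,x)+\alpha h(x)\big)\frac{P^{-1}\nabla h(x)}{\|\nabla h(x)\|_{P^{-1}}^2}$$ (the correction term being $0$ when $x\in\mathcal{S}$ and $\nabla h(x)=0$). Solutions: a solution on $[0,T]$ is an absolutely continuous function with the prescribed initial value that satisfies the differential equation/inclusion (and the state constraint, if any) for almost all $t\in[0,T]$. Constant: $$\alpha_*=\frac{\max_{(z,x)\in\mathcal{Z}\times\mathcal{S}}|\mathcal{L}_fh(z,x)|}{\gamma^{-1}\Big(\frac{\min_{y\in\partial\mathcal{S}}\|\nabla h(y)\|-\epsilon}{L_{\nabla h}}\Big)}.$$ *)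

(* Defs.v *)
From HB Require Import structures.
From mathcomp Require Import all_boot all_order all_algebra.
From mathcomp Require Import all_classical all_reals all_analysis.
Set Implicit Arguments.
Unset Strict Implicit.
Unset Printing Implicit Defensive.
Import Order.TTheory GRing.Theory Num.Theory.
Import numFieldNormedType.Exports.
Local Open Scope classical_set_scope.
Local Open Scope ring_scope.

(* Vectors of R^k are row vectors. Their topology is the library's (from the
   max norm, hence the Euclidean topology); quantitative statements use the
   Euclidean norm [enorm]. *)
Section Vectors.
Context {R : realType} {n : nat}.
Implicit Types (u v x : 'rV[R]_n) (P : 'M[R]_n) (A : set 'rV[R]_n).

Definition dotv u v : R := (u *m v^T) 0 0.

Definition enorm v : R := Num.sqrt (dotv v v).

Definition posdef P : Prop :=
  P^T = P /\ forall v, v != 0 -> 0 < (v *m P *m v^T) 0 0.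

Definition pnorm P v : R := Num.sqrt ((v *m P *m v^T) 0 0).

(* The infimum is attained for A closed and nonempty. *)
Definition dist_to x A : R := inf [set enorm (x - y) | y in A].

Definition boundary A : set 'rV[R]_n := closure A `\` interior A.

Definition gradient (h : 'rV[R]_n -> R) x : 'rV[R]_n :=
  \row_(i < n) 'd h x (delta_mx 0 i).

Definition tangent_cone A x : set 'rV[R]_n :=
  [set w | exists (u : nat -> 'rV[R]_n) (t : nat -> R),
    [/\ forall i, A (u i), u i @[i --> \oo] --> x,
        forall i, 0 < t i, t i @[i --> \oo] --> (0 : R) &
        (t i)^-1 *: (u i - x) @[i --> \oo] --> w] ].

Definition superlevel (h : 'rV[R]_n -> R) : set 'rV[R]_n := [set x | 0 <= h x].

End Vectors.

Definition argmin {R : realType} {V : Type} (A : set V) (F : V -> R) : set V :=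
  [set mu | A mu /\ forall nu, A nu -> F mu <= F nu].

(* Only the values of gamma on [0, +oo[ matter. *)
Definition Kinfty {R : realType} (gamma : R -> R) : Prop :=
  [/\ {within `[0, +oo[, continuous gamma},
      {in `[0, +oo[ &, {homo gamma : a b / a < b}},
      gamma 0 = 0 & gamma a @[a --> +oo] --> +oo].

Definition Kinfty_inv {R : realType} (gamma : R -> R) : R -> R :=
  'pinv_(fun=> 0) `[0, +oo[ gamma.

Definition abs_continuous {R : realType} {V : normedModType R}
    (a b : R) (phi : R -> V) : Prop :=
  forall e, 0 < e -> exists2 d, 0 < d &
    forall (N : nat) (s t : 'I_N -> R),
      (forall i, a <= s i /\ s i <= t i /\ t i <= b) ->
      trivIset [set: 'I_N] (fun i => `]s i, t i[%classic) ->
      \sum_(i < N) (t i - s i) < d ->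
      \sum_(i < N) `|phi (t i) - phi (s i)| < e.

(* The solution is a function on R of which only the restriction to [0, T]
   matters; a pointwise differential equation is an inclusion with F p a
   singleton, and F p is empty where p violates the state constraint. *)
Definition solution {R : realType} {V : normedModType R}
    (F : V -> set V) (T : R) (p0 : V) (phi : R -> V) : Prop :=
  [/\ phi 0 = p0, abs_continuous 0 T phi &
      {ae lebesgue_measure, forall t : R, t \in `[0, T] ->
        derivable phi t 1 /\ F (phi t) (derive1 phi t)}].

Section Dynamics.
Context {R : realType} {m n : nat}.
Implicit Types (h : 'rV[R]_n -> R) (P : 'M[R]_n) (gamma : R -> R).
Implicit Types (f : 'rV[R]_m * 'rV[R]_n -> 'rV[R]_n).
Implicit Types (g : 'rV[R]_m * 'rV[R]_n -> 'rV[R]_m).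
Implicit Types (p : 'rV[R]_m * 'rV[R]_n) (Z : set 'rV[R]_m).

Definition lie f h p : R := dotv (gradient h p.2) (f p).

Definition pds_field h P f g p : set ('rV[R]_m * 'rV[R]_n) :=
  [set v | [/\ superlevel h p.2, v.1 = g p &
    argmin (tangent_cone (superlevel h) p.2)
           (fun mu => pnorm P (mu - f p) ^+ 2) v.2]].

(* The minimizer exists and is unique when P is positive definite and the
   constraint is feasible, in particular whenever p.2 is in superlevel h;
   the default value 0 is used only when there is no minimizer. *)
Definition f_cbf h P f (alpha : R) p : 'rV[R]_n :=
  xget 0 (argmin [set mu | 0 <= dotv (gradient h p.2) mu + alpha * h p.2]
                 (fun mu => pnorm P (mu - f p) ^+ 2)).

Definition cbf_field h P f g (alpha : R) p : set ('rV[R]_m * 'rV[R]_n) :=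
  [set (g p, f_cbf h P f alpha p)].

(* This inf and the sup below are attained, i.e. are a min and a max, when
   superlevel h and Z are compact and nonempty, n > 0, and lie f h and
   gradient h are continuous. *)
Definition min_boundary_gradient h : R :=
  inf [set enorm (gradient h y) | y in boundary (superlevel h)].

Definition alpha_star h f Z gamma (L eps : R) : R :=
  sup [set `|lie f h p| | p in Z `*` superlevel h] /
  Kinfty_inv gamma ((min_boundary_gradient h - eps) / L).

End Dynamics.

(* Main.v *)
Require Import Defs.
From HB Require Import structures.
From mathcomp Require Import all_boot all_order all_algebra.
From mathcomp Require Import all_classical all_reals all_analysis.
From mathcomp Require Import measurable_realfun ring lra.
Set Implicit Arguments.
Unset Strict Implicit.
Unset Printing Implicit Defensive.
Import Order.TTheory GRing.Theory Num.Theory.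
Import numFieldNormedType.Exports.
Local Open Scope classical_set_scope.
Local Open Scope ring_scope.

(** Only large [alpha i] matter: by compactness, where the constraint of the
    quadratic program is active, [h] is small, so the gradient stays away from
    zero and the fields are bounded uniformly in [i]. The [phi_ i] are thus
    equi-Lipschitz and a subsequence converges uniformly to some Lipschitz
    [psi = (zeta, xi)].

    The derivative of the limit is identified pointwise. For [zeta], and for
    [xi] when [h (xi t) > 0], the fields converge uniformly near [psi t], and a
    mean value inequality passes to the limit. When [h (xi t) = 0], put
    [a = gradient h (xi t)]: the correction term of the field is a bounded
    multiple of a vector close to the P-normal of [a], so the same argument gives
    the derivative of the component of [xi] tangential to [a]; the normal
    component has derivative 0 as soon as [t] is a density point of
    [{s | h (xi s) = 0}], hence for almost all such [t]. Since the corrections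
    point inwards, [a] and [f (psi t)] have a nonpositive scalar product, and the
    derivative is the P-projection of [f (psi t)] on the tangent half-space.

    Uniqueness is a Gronwall estimate on [|zeta|^2 + |xi|_P^2] for the difference
    of two solutions, and gives the convergence of the whole sequence. *)

(** * Cousin's lemma and absolutely continuous functions *)

Section IntervalFunctions.
Context {R : realType}.
Implicit Types (a b c s t u e : R).

(** Encodes finitely many non-overlapping subintervals in increasing order. Gaps are allowed, since
    only the pieces of a partition whose tag is bad get recorded. *)
Definition chain s u (l : seq (R * R)) : bool :=
  all (fun p => (s <= p.1) && (p.1 <= p.2) && (p.2 <= u)) l &&
  pairwise (fun p q : R * R => p.2 <= q.1) l.

Lemma chain_cat s t u l1 l2 : s <= t -> t <= u ->
  chain s t l1 -> chain t u l2 -> chain s u (l1 ++ l2).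
Proof.
move=> st tu /andP[/allP a1 p1] /andP[/allP a2 p2].
rewrite /chain all_cat pairwise_cat p1 p2 !andbT -andbA; apply/and3P; split.
- by apply/allP => p /a1 /andP[-> /= /le_trans]; apply.
- by apply/allP => p /a2 /andP[/andP[/(le_trans st) -> ->] ->].
- by apply/allrelP => p q /a1 /andP[_ pt] /a2 /andP[/andP[tq _] _];
    exact: le_trans tq.
Qed.

(** Interval induction at the supremum of the endpoints reachable from [a]: joining a reachable
    point just below it to a point just above it shows that it equals [b] and is reached. *)
Lemma cousin a b (Pr : R -> R -> Prop) : a <= b ->
  (forall s t u, a <= s -> s <= t -> t <= u -> u <= b ->
    Pr s t -> Pr t u -> Pr s u) ->
  (forall t, a <= t <= b -> exists2 d, 0 < d &
    forall s u, a <= s -> s <= t -> t <= u -> u <= b -> u - s < d -> Pr s u) ->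
  Pr a b.
Proof.
move=> ab add loc.
pose E := [set x | a <= x <= b /\ Pr a x].
have Ea : E a.
  have [|d d0 H] := loc a; first by rewrite lexx.
  by split; [rewrite lexx|apply: H; rewrite // subrr].
have Eub : has_ubound E by exists b => x [/andP[]].
have hE : has_sup E by split => //; exists a.
have ac : a <= sup E by exact: ub_le_sup.
have cb : sup E <= b by apply: ge_sup; [exists a|move=> x [/andP[]]].
have [|d d0 H] := loc (sup E); first by rewrite ac.
have d20 : 0 < d / 2 by lra.
have [x [/andP[ax xb] Pax] cx] := sup_adherent d20 hE.
have xc : x <= sup E by apply: ub_le_sup => //; split; rewrite ?ax.
(* The interval from [x] to [v] contains [sup E] and is shorter than [d / 2 + d / 4], so the local
   hypothesis covers it. *)
pose v := Num.min b (sup E + d / 4).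
have cv : sup E <= v by rewrite le_min cb /=; lra.
have vd : v <= sup E + d / 4 by rewrite ge_min lexx orbT.
have vb : v <= b by rewrite ge_min lexx.
have Pv : Pr a v.
  apply: (add a x v) => //; first by lra.
  by apply: H => //; lra.
have : v <= sup E by apply: ub_le_sup => //; split=> //; rewrite vb andbT; lra.
rewrite /v ge_min => /orP[bc|]; last by lra.
by have -> : b = v by apply/le_anti; rewrite vb andbT (le_trans bc).
Qed.

Lemma chain_trivIset (l : seq (R * R)) :
  pairwise (fun p q : R * R => p.2 <= q.1) l ->
  trivIset setT (fun i : 'I_(size l) =>
    `](nth (0, 0) l i).1, (nth (0, 0) l i).2[%classic).
Proof.
move=> pl; set F := (X in trivIset _ X).
have H (i j : 'I_(size l)) : (i < j)%N -> F i `&` F j = set0.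
  move=> ij; rewrite -subset0 => x [] /=; rewrite /F /= !in_itv/=.
  have := pairwiseP (0, 0) pl; move/(_ i j).
  rewrite !inE => /(_ (ltn_ord _) (ltn_ord _) ij).
  by move=> ? /andP[_ ?] /andP[? _]; lra.
apply/trivIsetP => i j _ _.
have [||/val_inj ->] := ltngtP i j; [by move=> /H|move=> /H; by rewrite setIC|].
by rewrite eqxx.
Qed.

Lemma chain_measure s u l (U : set R) : chain s u l -> measurable U ->
  (forall p, p \in l -> `]p.1, p.2[%classic `<=` U) ->
  ((\sum_(p <- l) (p.2 - p.1))%:E <= lebesgue_measure U)%E.
Proof.
move=> /andP[/allP al pl] mU lU.
rewrite (big_nth (0, 0)) big_mkord.
pose F (i : 'I_(size l)) := `](nth (0, 0) l i).1, (nth (0, 0) l i).2[%classic.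
have mF i : measurable (F i) by exact: measurable_itv.
have tF : trivIset setT F by exact: chain_trivIset.
have -> : (\sum_(i < size l) ((nth (0, 0) l i).2 - (nth (0, 0) l i).1))%:E =
    lebesgue_measure (\big[setU/set0]_(i < size l) F i).
  rewrite measure_bigsetU_ord_cond//; first last.
  - by apply: sub_trivIset tF.
  - by move=> i _; exact: mF.
  rewrite -sumEFin; apply: eq_bigr => i _.
  rewrite [RHS]lebesgue_measure_itv/= lte_fin.
  have /andP[/andP[_ +] _] := al _ (mem_nth (0, 0) (ltn_ord i)).
  by rewrite le_eqVlt => /predU1P[->|->]//; rewrite ltxx subrr.
apply: le_measure; rewrite ?inE//.
  by apply: bigsetU_measurable => i _; exact: mF.
elim/big_ind : _ => // [A B ? ?|i _]; first by rewrite subUset.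
exact: lU (mem_nth _ (ltn_ord i)).
Qed.

(* Gauge argument: at the good points t the gauge gives the local bound, and at
   the other ones it keeps the intervals inside an open set of small measure.
   Cousin's lemma provides a fine tagged partition, and absolute continuity
   bounds the total contribution of the intervals with a bad tag. *)
Lemma abs_continuous_interval {V : normedModType R} (phi : R -> V) a b K
    (Phi : R -> R -> R) : a <= b -> 0 <= K -> abs_continuous a b phi ->
  (forall s t u, a <= s -> s <= t -> t <= u -> u <= b ->
     Phi s u <= Phi s t + Phi t u) ->
  (forall s u, a <= s -> s <= u -> u <= b ->
     Phi s u <= K * (`|phi u - phi s| + (u - s))) ->
  {ae lebesgue_measure, forall t : R, t \in `[a, b] -> forall e, 0 < e ->
     exists2 d, 0 < d & forall s u, a <= s -> s <= t -> t <= u -> u <= b ->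
       u - s < d -> Phi s u <= e * (u - s)} ->
  Phi a b <= 0.
Proof.
move=> ab K0 ac add dom [N [mN N0 sN]].
apply/ler_addgt0Pl => e0 e00; rewrite addr0.
(* Budget: the good intervals cost at most [e * (b - a)]; the bad ones have variation below [e] and
   length below [d <= e], hence cost at most [K * (2 * e)]. *)
pose e := e0 / (b - a + 2 * K + 1).
have den0 : 0 < b - a + 2 * K + 1 by lra.
have e_gt0 : 0 < e by rewrite divr_gt0.
have [d0 d00 Hd0] := ac e e_gt0.
pose d := Num.min d0 e.
have d_gt0 : 0 < d by rewrite lt_min d00.
have [|U [oU NU mU]] := lebesgue_regularity_outer mN _ d_gt0.
  by rewrite [X in (X < _)%E]N0.
have mU' : measurable U by exact: open_measurable.
have {}mU : (lebesgue_measure U < d%:E)%E.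
  rewrite -(setDUK NU).
  rewrite measureU//; [by rewrite [X in (X + _)%E]N0 add0e|exact: measurableD|].
  by rewrite setDIK.
pose S (l : seq (R * R)) := \sum_(p <- l) (`|phi p.2 - phi p.1| + (p.2 - p.1)).
suff [l [cl lU PhiS]] : exists l, [/\ chain a b l,
    forall p, p \in l -> `]p.1, p.2[%classic `<=` U &
    Phi a b <= e * (b - a) + K * S l].
  have ml : \sum_(p <- l) (p.2 - p.1) < d.
    by rewrite -lte_fin; apply: le_lt_trans mU; exact: chain_measure cl _ _.
  have vl : \sum_(p <- l) `|phi p.2 - phi p.1| < e.
    rewrite (big_nth (0, 0)) big_mkord.
    move: cl => /andP[/allP al pl].
    apply: (Hd0 _ (fun i => (nth (0, 0) l i).1) (fun i => (nth (0, 0) l i).2)).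
    - move=> i; have := al _ (mem_nth (0, 0) (ltn_ord i)).
      by move=> /andP[/andP[-> ->] ->].
    - exact: chain_trivIset pl.
    - rewrite (big_nth (0, 0)) big_mkord in ml.
      by apply: lt_le_trans ml _; rewrite ge_min lexx.
  have Sl : S l <= 2 * e.
    rewrite /S big_split/=.
    have : d <= e by rewrite ge_min lexx orbT.
    lra.
  have : K * S l <= K * (2 * e) by rewrite ler_wpM2l.
  have -> : e0 = e * (b - a + 2 * K + 1) by rewrite divfK// gt_eqF.
  by have := e_gt0; nra.
have nnS l : chain a b l -> 0 <= S l.
  move=> /andP[/allP al _]; rewrite /S big_seq; apply: sumr_ge0 => p /al.
  by move=> /andP[/andP[_ ?] _]; rewrite addr_ge0// subr_ge0.
(* The predicate carries the list of the intervals with a bad tag collected so far. *)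
apply: (@cousin a b (fun s u => exists l, [/\ chain s u l,
    forall p, p \in l -> `]p.1, p.2[%classic `<=` U &
    Phi s u <= e * (u - s) + K * S l])) => //.
  move=> s t u as_ st tu ub [l1 [c1 U1 P1]] [l2 [c2 U2 P2]].
  exists (l1 ++ l2); split; first exact: chain_cat c1 c2.
    by move=> p; rewrite mem_cat => /orP[/U1|/U2].
  rewrite (le_trans (add _ _ _ as_ st tu ub))// /S big_cat/= -!/(S _).
  by rewrite (le_trans (lerD P1 P2))// mulrDr; lra.
move=> t tab; have [tN|tN] := pselect (N t).
  have /nbhs_ballP[r /= r0 rU] : nbhs t U by apply: open_nbhs_nbhs; split => //; exact: NU.
  exists r => // s u as_ st tu ub us; exists [:: (s, u)]; split.
  - by rewrite /chain/= !lexx (le_trans st).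
  - move=> p; rewrite inE => /eqP -> x /=; rewrite in_itv/= => /andP[sx xu].
    by apply: rU; rewrite /ball/= ltr_norml; lra.
  - rewrite /S big_seq1 (le_trans (dom _ _ as_ (le_trans st tu) ub))//= lerDr.
    by rewrite mulr_ge0// ?(ltW e_gt0)//; lra.
have /contrapT : ~ ~ forall e, 0 < e ->
     exists2 d, 0 < d & forall s u, a <= s -> s <= t -> t <= u -> u <= b ->
       u - s < d -> Phi s u <= e * (u - s).
  by move=> H; apply/tN/sN => /=; apply: contra_not H; apply; rewrite in_itv.
move=> /(_ _ e_gt0)[r r0 H]; exists r => // s u as_ st tu ub us.
exists [::]; split => //; rewrite /S big_nil mulr0 addr0; exact: H.
Qed.

End IntervalFunctions.

(** * Projections on half-spaces and tangent cones *)

Section Dotv.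
Context {R : realType} {n : nat}.
Implicit Types (u v w a : 'rV[R]_n) (M P : 'M[R]_n).

Lemma dotvE u v : dotv u v = \sum_j u 0 j * v 0 j.
Proof. by rewrite /dotv mxE; apply: eq_bigr => j _; rewrite mxE. Qed.

Lemma dotvC u v : dotv u v = dotv v u.
Proof. by rewrite !dotvE; apply: eq_bigr => j _; rewrite mulrC. Qed.

Lemma dotvDr u v w : dotv u (v + w) = dotv u v + dotv u w.
Proof. by rewrite /dotv linearD mulmxDr mxE. Qed.

Lemma dotvZr k u v : dotv u (k *: v) = k * dotv u v.
Proof. by rewrite /dotv linearZ -scalemxAr mxE. Qed.

Lemma dotvNr u v : dotv u (- v) = - dotv u v.
Proof. by rewrite -scaleN1r dotvZr mulN1r. Qed.

Lemma dotvBr u v w : dotv u (v - w) = dotv u v - dotv u w.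
Proof. by rewrite dotvDr dotvNr. Qed.

Lemma dotvDl u v w : dotv (u + v) w = dotv u w + dotv v w.
Proof. by rewrite ![dotv _ w]dotvC dotvDr. Qed.

Lemma dotvZl k u v : dotv (k *: u) v = k * dotv u v.
Proof. by rewrite ![dotv _ v]dotvC dotvZr. Qed.

Lemma dotvBl u v w : dotv (u - v) w = dotv u w - dotv v w.
Proof. by rewrite ![dotv _ w]dotvC dotvBr. Qed.

Lemma dotv0r u : dotv u 0 = 0.
Proof. by rewrite -(scale0r (0 : 'rV[R]_n)) dotvZr mul0r. Qed.

Lemma dotv0l u : dotv 0 u = 0. Proof. by rewrite dotvC dotv0r. Qed.

Lemma dotv_sum I (r : seq I) (Pr : pred I) u (F : I -> 'rV[R]_n) :
  dotv u (\sum_(i <- r | Pr i) F i) = \sum_(i <- r | Pr i) dotv u (F i).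
Proof. by apply: (big_morph _ (dotvDr u) (dotv0r u)). Qed.

Lemma dotv_delta u j : dotv u (delta_mx 0 j) = u 0 j.
Proof.
rewrite dotvE (bigD1 j)//= mxE !eqxx mulr1 big1 ?addr0// => i ij.
by rewrite mxE eqxx (negPf ij) mulr0.
Qed.

Lemma dotvv_ge0 u : 0 <= dotv u u.
Proof. by rewrite dotvE sumr_ge0// => j _; rewrite -expr2 sqr_ge0. Qed.

Lemma dotvv_gt0 u : u != 0 -> 0 < dotv u u.
Proof.
move=> u0; rewrite lt_def dotvv_ge0 andbT; apply: contra u0.
rewrite dotvE psumr_eq0 => [/allP H|j _]; last by rewrite -expr2 sqr_ge0.
apply/eqP/rowP => j; rewrite mxE.
by have := H j (mem_index_enum _); rewrite -expr2 sqrf_eq0 => /eqP.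
Qed.

Lemma coord_le_norm u j : `|u 0 j| <= `|u|.
Proof. by rewrite [leRHS]mx_normrE (le_bigmax _ _ (0, j)). Qed.

Lemma normr_row_le u k : 0 <= k -> (forall j, `|u 0 j| <= k) -> `|u| <= k.
Proof.
move=> k0 uk; rewrite [leLHS]mx_normrE; apply: bigmax_le => // -[i j] _ /=.
by rewrite ord1.
Qed.

(** [|u|] is the max norm, hence the factor [n]. *)
Lemma dotv_le u v : `|dotv u v| <= n%:R * `|u| * `|v|.
Proof.
rewrite dotvE (le_trans (ler_norm_sum _ _ _))//.
apply: (@le_trans _ _ (\sum_(j < n) `|u| * `|v|)).
  by apply: ler_sum => j _; rewrite normrM ler_pM// coord_le_norm.
by rewrite sumr_const card_ord -[leLHS]mulr_natl mulrA.
Qed.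

Lemma mulmx_bounded M : exists2 C, 0 <= C & forall u, `|u *m M| <= C * `|u|.
Proof.
exists (n%:R * `|M|) => [|u]; first by rewrite mulr_ge0.
apply: normr_row_le => [|j]; first by rewrite !mulr_ge0.
rewrite mxE (le_trans (ler_norm_sum _ _ _))//.
apply: (@le_trans _ _ (\sum_(k < n) `|u| * `|M|)).
  apply: ler_sum => k _; rewrite normrM ler_pM// ?coord_le_norm//.
  by rewrite [leRHS]mx_normrE (le_bigmax _ _ (k, j)).
by rewrite sumr_const card_ord -[leLHS]mulr_natl mulrA mulrAC.
Qed.

Lemma cvg_dotv T (F : set_system T) {FF : Filter F} (f g : T -> 'rV[R]_n) u v :
  f x @[x --> F] --> u -> g x @[x --> F] --> v ->
  dotv (f x) (g x) @[x --> F] --> dotv u v.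
Proof.
move=> fu gv; rewrite dotvE (eq_cvg _ _ (fun x => dotvE (f x) (g x))).
refine (cvg_big (@add_continuous R) _ (Ff := fun j x => f x 0 j * g x 0 j) _).
move=> j _; have cj := @coord_continuous R 1 n 0 j.
by apply: cvgM; [exact: cvg_comp fu (cj u)|exact: cvg_comp gv (cj v)].
Qed.

Lemma mulmx_continuous M : continuous (fun u : 'rV[R]_n => u *m M).
Proof.
have [C C0 H] := mulmx_bounded M.
have C1 : 0 < C + 1 by lra.
move=> u; apply/(@cvgrPdist_le _ _ _ (nbhs u) (nbhs_filter u)) => e e0; apply/nbhs_ballP.
exists (e / (C + 1)) => [|v]; first by rewrite /= divr_gt0.
rewrite -ball_normE /= ltr_pdivlMr// => uv.
rewrite -mulmxBl (le_trans (H _))//.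
by have := normr_ge0 (u - v); nra.
Qed.

End Dotv.

Section HalfSpace.
Context {R : realType} {n : nat}.
Implicit Types (u v w a f : 'rV[R]_n) (P : 'M[R]_n).

Definition pform P u v := dotv (u *m P) v.

Lemma pnorm_sqr P v : posdef P -> pnorm P v ^+ 2 = pform P v v.
Proof.
move=> [_ P0]; rewrite sqr_sqrtr//.
by have [->|/P0/ltW//] := eqVneq v 0; rewrite !mul0mx mxE.
Qed.

Lemma pform_gt0 P v : posdef P -> v != 0 -> 0 < pform P v v.
Proof. by move=> [_ /[apply]]. Qed.

Lemma pform_ge0 P v : posdef P -> 0 <= pform P v v.
Proof.
move=> pP; have [->|/(pform_gt0 pP)/ltW//] := eqVneq v 0.
by rewrite /pform dotv0r.
Qed.

Lemma pformC P u v : posdef P -> pform P u v = pform P v u.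
Proof.
move=> [PT _]; rewrite /pform dotvC /dotv trmx_mul PT mulmxA.
by [].
Qed.

Lemma pform_sqrD P u v : posdef P ->
  pform P (u + v) (u + v) = pform P u u + 2 * pform P v u + pform P v v.
Proof.
move=> pP; rewrite {1}/pform mulmxDl dotvDl !dotvDr -!/(pform _ _ _).
by rewrite (pformC u v pP); ring.
Qed.

Lemma posdef_unitmx P : posdef P -> P \in unitmx.
Proof.
move=> pP; rewrite -row_free_unit -kermx_eq0; apply/eqP/row_matrixP => i.
rewrite row0; apply/eqP/negPn/negP => /(pform_gt0 pP).
by rewrite /pform -row_mul mulmx_ker row0 dotv0l ltxx.
Qed.

Lemma pform_invmx P a v : posdef P -> pform P (a *m invmx P) v = dotv a v.
Proof. by move=> pP; rewrite /pform mulmxKV// posdef_unitmx. Qed.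

Lemma dotv_invmx_gt0 P a : posdef P -> a != 0 -> 0 < dotv a (a *m invmx P).
Proof.
move=> pP a0; rewrite -(pform_invmx _ _ pP) pform_gt0//.
apply: contra a0 => /eqP E.
by rewrite -(mulmxKV (posdef_unitmx pP) a) E mul0mx.
Qed.

(** The [P]-normal of the hyperplane orthogonal to [a], scaled to have product 1 with [a]. It is 0
    when [a = 0], which lets one formula cover absent constraints. *)
Definition pnormal P a := (dotv a (a *m invmx P))^-1 *: (a *m invmx P).

Definition halfspace_proj P a b f := f - Num.min 0 (dotv a f + b) *: pnormal P a.

Lemma dotv_pnormal P a : posdef P -> a != 0 -> dotv a (pnormal P a) = 1.
Proof. by move=> pP a0; rewrite dotvZr mulVf// gt_eqF// dotv_invmx_gt0. Qed.

(** Minimality and uniqueness both come from [key]: [x - f] is a nonnegative multiple of the normal,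
    so its [P]-product with [mu - x] is nonnegative for every feasible [mu]. The condition on [a]
    and [b] is the feasibility of the constraint. *)
Lemma argmin_halfspace P a b f : posdef P -> a != 0 \/ 0 <= b ->
  argmin [set mu | 0 <= dotv a mu + b] (fun mu => pnorm P (mu - f) ^+ 2) =
  [set halfspace_proj P a b f].
Proof.
move=> pP ab; set A := [set mu | _]; set x := halfspace_proj P a b f.
set m := Num.min 0 (dotv a f + b).
have m0 : m <= 0 by rewrite ge_min lexx.
have a0 : m < 0 -> a != 0.
  rewrite /m gt_min ltxx/= => mlt; case: ab => // b0; apply: contraTneq mlt => ->.
  by rewrite dotv0l add0r -leNgt.
have ax : m < 0 -> dotv a x = - b.
  move=> mlt; rewrite /x /halfspace_proj dotvBr dotvZr -/m dotv_pnormal ?a0//.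
  by move: mlt; rewrite /m gt_min ltxx/= => /ltW ml; rewrite min_r//; lra.
have Ax : A x.
  have [mlt|mge] := ltP m 0; first by rewrite /A/= ax// addNr.
  have Em : m = 0 by apply/le_anti; rewrite m0 mge.
  by rewrite /A/= /x /halfspace_proj -/m Em scale0r subr0; move: mge;
    rewrite /m le_min => /andP[].
have key mu : A mu -> pform P (x - f) (x - f) + pform P (mu - x) (mu - x) <=
    pform P (mu - f) (mu - f).
  move=> Amu.
  have -> : mu - f = (mu - x) + (x - f) by rewrite subrKA.
  have Exf : x - f = - m *: pnormal P a.
    by rewrite /x /halfspace_proj addrC addKr -/m scaleNr.
  have cross : 0 <= pform P (x - f) (mu - x).
    rewrite Exf /pnormal scalerA /pform -scalemxAl dotvZl -/(pform _ _ _).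
    rewrite pform_invmx//.
    have [mlt|mge] := ltP m 0; last first.
      by have -> : m = 0; [apply/le_anti; rewrite m0 mge|rewrite oppr0 !mul0r].
    rewrite mulr_ge0//; last by rewrite dotvBr ax//; move: Amu; rewrite /A/=; lra.
    by rewrite mulr_ge0 ?oppr_ge0// invr_ge0 ltW// dotv_invmx_gt0// a0.
  by rewrite (pform_sqrD (mu - x) (x - f) pP); lra.
apply/seteqP; split=> [mu [Amu mumin]|_ ->].
  have := mumin _ Ax; rewrite !pnorm_sqr// => H.
  have := key _ Amu => H2; apply/eqP; rewrite -subr_eq0; apply/negPn/negP.
  by move=> /(pform_gt0 pP); lra.
split => // mu /key H; rewrite !pnorm_sqr//.
by have := pform_ge0 (mu - x) pP; lra.
Qed.

End HalfSpace.

(** * First-order expansions *)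

Section Expansion.
Context {R : realType}.

Lemma differentiable_expansion {V W : normedModType R} (f : V -> W) x :
  differentiable f x -> forall e, 0 < e -> exists2 d, 0 < d &
    forall y, `|y - x| < d -> `|f y - f x - 'd f x (y - x)| <= e * `|y - x|.
Proof.
move=> /diff_locallyx; set k := 'o_ _ _ => fx e e0.
have /(_ _ e0) := littleoP k.
move=> /nbhs_ballP[d /= d0 kd]; exists d => // y yd.
have -> : f y = f (y - x + x) by rewrite subrK.
rewrite fx -[X in `|X|]addrA -opprD addrAC subrr add0r.
by apply: kd; rewrite -ball_normE/= sub0r normrN.
Qed.

Context {V : normedModType R}.
Implicit Types (phi : R -> V) (t : R).

Lemma derivable_expansion phi t : derivable phi t 1 ->
  forall e, 0 < e -> exists2 d, 0 < d & forall s, `|s - t| < d ->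
    `|phi s - phi t - (s - t) *: derive1 phi t| <= e * `|s - t|.
Proof.
move=> /derivable1_diffP dphi e e0.
have [d d0 H] := differentiable_expansion dphi e0; exists d => // s /H.
by rewrite derive1E'// -linearZ/= [_%:A]mulr1.
Qed.

Lemma increment_drift phi v s t :
  phi t - phi s - (t - s) *: v = (phi t - t *: v) - (phi s - s *: v).
Proof.
by rewrite scalerBl !opprB [s *: v - _]addrC addrACA [- _ + s *: v]addrC.
Qed.

(** The gauge argument needs intervals around [t] rather than starting at it: subtract the
    expansions at the two endpoints, whose distances to [t] add up to [u - s]. *)
Lemma derivable_straddle phi t : derivable phi t 1 ->
  forall e, 0 < e -> exists2 d, 0 < d & forall s u, s <= t -> t <= u ->
    u - s < d -> `|phi u - phi s - (u - s) *: derive1 phi t| <= e * (u - s).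
Proof.
move=> /derivable_expansion H e e0; have [d d0 {}H] := H _ e0.
exists d => // s u st tu us; have := H s; have := H u.
rewrite ger0_norm ?subr_ge0// ler0_norm ?subr_le0// opprB.
move=> /(_ ltac:(lra)) Hu /(_ ltac:(lra)) Hs.
have -> : phi u - phi s - (u - s) *: derive1 phi t =
    (phi u - phi t - (u - t) *: derive1 phi t) -
    (phi s - phi t - (s - t) *: derive1 phi t).
  by rewrite !increment_drift [- (_ - (phi t - _))]opprB addrA subrK.
by rewrite (le_trans (ler_normB _ _))//; lra.
Qed.

Lemma expansion_derivable phi t v :
  (forall e, 0 < e -> exists2 d, 0 < d & forall s, `|s - t| < d ->
    `|phi s - phi t - (s - t) *: v| <= e * `|s - t|) ->
  derivable phi t 1 /\ derive1 phi t = v.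
Proof.
move=> H; suff cv : (h^-1 *: (phi (h + t) - phi t) @[h --> 0^'] --> v).
  split; last exact: cvg_lim cv.
  apply/cvg_ex; exists v; move: cv; apply: cvg_trans.
  by apply: near_eq_cvg; near=> h; rewrite /= [h%:A]mulr1.
apply/cvgrPdist_le => e e0; have [d d0 {}H] := H _ e0.
near=> h.
have h0 : h != 0 by near: h; exact: nbhs_dnbhs_neq.
have := H (h + t); rewrite addrK => /(_ _) H1.
have {}H1 : `|phi (h + t) - phi t - h *: v| <= e * `|h|.
  apply: H1; near: h; apply: dnbhs0_lt; exact: d0.
rewrite distrC -[v in X in X <= _](scalerK h0) -scalerBr normrZ normfV.
by rewrite ler_pdivrMl ?normr_gt0// mulrC.
Unshelve. all: by end_near. Qed.

End Expansion.

Section TangentCone.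
Context {R : realType} {n : nat} (h : 'rV[R]_n -> R).
Hypothesis h_diff : forall x, differentiable h x.
Hypothesis grad_neq0 : forall x, h x = 0 -> gradient h x != 0.

Lemma diff_gradient x v : 'd h x v = dotv (gradient h x) v.
Proof.
rewrite [in LHS](row_sum_delta v) [in RHS](row_sum_delta v) linear_sum dotv_sum.
by apply: eq_bigr => j _; rewrite linearZ dotvZr dotv_delta mxE.
Qed.

Lemma gradient_expansion x e : 0 < e -> exists2 d, 0 < d &
  forall y, `|y - x| < d ->
    `|h y - h x - dotv (gradient h x) (y - x)| <= e * `|y - x|.
Proof.
move=> e0; have [d d0 H] := differentiable_expansion (h_diff x) e0.
by exists d => // y /H; rewrite diff_gradient.
Qed.

Lemma continuous_h : continuous h.
Proof. by move=> x; exact: differentiable_continuous. Qed.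

(* Zero at interior points, where the tangent cone is the whole space. *)
Definition active_normal x := if h x == 0 then gradient h x else 0.

(** Adding a small multiple of the gradient makes a boundary direction point strictly inward, so the
    first-order term beats the remainder. At an interior point continuity suffices. *)
Lemma descent_room x w : 0 <= h x -> 0 <= dotv (active_normal x) w ->
  forall c, 0 < c -> exists2 d, 0 < d &
    forall t, 0 < t -> t < d -> 0 <= h (x + t *: (w + c *: gradient h x)).
Proof.
rewrite /active_normal => hx wa c c0; set w' := w + _.
have w1 : 0 < `|w'| + 1 by rewrite ltr_wpDl.
have [hx0|hx0] := eqVneq (h x) 0.
  move: wa; rewrite hx0 eqxx => wa; have g0 := dotvv_gt0 (grad_neq0 hx0).
  have gw' : 0 < dotv (gradient h x) w' by rewrite dotvDr dotvZr ltr_wpDl// mulr_gt0.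
  have [|d d0 H] := @gradient_expansion x (dotv (gradient h x) w' / (`|w'| + 1)).
    by rewrite divr_gt0.
  exists (d / (`|w'| + 1)); first by rewrite divr_gt0.
  move=> t t0; rewrite ltr_pdivlMr// => td.
  have := H (x + t *: w'); rewrite addrC addKr normrZ gtr0_norm// hx0 subr0 dotvZr.
  have tw : t * `|w'| < d by nra.
  move=> /(_ tw); rewrite ler_norml => /andP[+ _].
  set E := _ / _ => HE.
  have E0 : 0 < t * E by rewrite mulr_gt0// divr_gt0.
  have EE : E * (`|w'| + 1) = dotv (gradient h x) w' by rewrite divfK// gt_eqF.
  have : t * (E * (`|w'| + 1)) = t * dotv (gradient h x) w' by rewrite EE.
  by nra.
have {}hx0 : 0 < h x by rewrite lt_def hx0.
have /cvgrPdist_lt/(_ _ hx0) := @continuous_h x.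
move=> /nbhs_ballP[d /= d0 H].
exists (d / (`|w'| + 1)); first by rewrite divr_gt0.
move=> t t0; rewrite ltr_pdivlMr// => td.
have := H (x + t *: w'); rewrite -ball_normE/= opprD addrA subrr add0r normrN.
rewrite normrZ gtr0_norm// => /(_ ltac:(nra)).
by rewrite ltr_norml; lra.
Qed.

(** For a feasible [w], the directions [w + gradient h x / (k + 1)] have room and tend to [w].
    Conversely, a direction along which [h] decreases at first order would make [h (u k)] negative.
    The summand 0 matches the constraint of [argmin_halfspace]. *)
Lemma tangent_cone_superlevel x : 0 <= h x ->
  tangent_cone (superlevel h) x = [set w | 0 <= dotv (active_normal x) w + 0].
Proof.
move=> hx; apply/seteqP; split=> w /=; rewrite addr0; last first.
  move=> wa.
  have /choice[t tP] : forall k : nat, exists t, [/\ 0 < t, t < k.+1%:R^-1 &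
      0 <= h (x + t *: (w + k.+1%:R^-1 *: gradient h x))].
    move=> k; have k0 : 0 < k.+1%:R^-1 :> R by rewrite invr_gt0.
    have [d d0 H] := descent_room hx wa k0.
    exists (Num.min d k.+1%:R^-1 / 2); split.
    - by rewrite divr_gt0// lt_min d0.
    - rewrite ltr_pdivrMr// mulr_natr; apply: (@le_lt_trans _ _ k.+1%:R^-1).
        by rewrite ge_min lexx orbT.
      by rewrite mulr2n ltrDl.
    - apply: H; first by rewrite divr_gt0// lt_min d0.
      rewrite ltr_pdivrMr// mulr_natr; apply: (@le_lt_trans _ _ d).
        by rewrite ge_min lexx.
      by rewrite mulr2n ltrDl.
  have harm0 : (k.+1%:R^-1 : R) @[k --> \oo] --> (0 : R) by exact: cvg_harmonic.
  have t0 : t k @[k --> \oo] --> (0 : R).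
    apply: (@squeeze_cvgr _ _ _ _ (fun=> 0) (fun k => k.+1%:R^-1)) => //; last exact: cvg_cst.
    by near=> k; have [/ltW -> /ltW ->] := tP k.
  have v0 : (w + k.+1%:R^-1 *: gradient h x) @[k --> \oo] --> w.
    rewrite -[X in _ --> X]addr0; apply: cvgD; first exact: cvg_cst.
    rewrite -(scale0r (gradient h x)); apply: cvgZ => //; exact: cvg_cst.
  exists (fun k => x + t k *: (w + k.+1%:R^-1 *: gradient h x)), t; split => //.
  - by move=> k; have [] := tP k.
  - rewrite -[X in _ --> X]addr0; apply: cvgD; first exact: cvg_cst.
    by rewrite -(scale0r w); apply: cvgZ.
  - by move=> k; have [] := tP k.
  - apply: cvg_trans v0; apply: near_eq_cvg; near=> k.
    have [tk _ _] := tP k.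
    by rewrite [x + _]addrC addrK scalerA mulVf ?scale1r// gt_eqF.
rewrite /active_normal; case: eqP => [hx0|]; last by rewrite dotv0l.
move=> [u [t [Su ux t0 tx cw]]]; rewrite leNgt; apply/negP => gw.
set delta := - dotv (gradient h x) w.
have delta0 : 0 < delta by rewrite oppr_gt0.
have w1 : 0 < `|w| + 1 by rewrite ltr_wpDl.
(* Once [|v k| <= |w| + 1], the remainder is at most [t k * delta / 4], while the linear term is
   below [- t k * delta / 2]. *)
have [|d d0 H] := @gradient_expansion x (delta / (4 * (`|w| + 1))).
  by rewrite divr_gt0// mulr_gt0.
pose v k := (t k)^-1 *: (u k - x).
have uv k : u k - x = t k *: v k.
  by rewrite /v scalerA mulfV ?scale1r// gt_eqF// t0.
have : \forall k \near \oo, False.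
  near=> k.
  have nv : `|v k| <= `|w| + 1.
    near: k; apply: (cvgr_norm_le w) => //; by rewrite ltrDl.
  have gv : dotv (gradient h x) (v k) < - (delta / 2).
    near: k; apply: (cvgr_lt (dotv (gradient h x) w)).
      by apply: cvg_dotv => //; exact: cvg_cst.
    by rewrite /delta; lra.
  have ud : `|u k - x| < d by near: k; apply: cvgr_distC_lt.
  have := H _ ud; rewrite hx0 subr0 ler_norml => /andP[_].
  rewrite uv dotvZr normrZ gtr0_norm//.
  have := Su k; rewrite /superlevel/= => huk.
  set E := delta / _ => Hk.
  have Ew : E * `|v k| <= delta / 4.
    have -> : delta / 4 = E * (`|w| + 1) by rewrite /E invfM mulrA divfK// gt_eqF.
    by rewrite ler_wpM2l// divr_ge0// ltW// mulr_gt0.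
  have := t0 k; nra.
by move=> /filter_ex [].
Unshelve. all: by end_near. Qed.

End TangentCone.

(** * The CBF and PDS fields *)

Section LocallyLipschitz.
Context {R : realType} {V W : normedModType R}.

(** Local Lipschitz continuity is stated on neighbourhoods of pairs; the pair [(x, x)] gives a
    two-point estimate on one ball. *)
Lemma locally_lipschitz_near (f : V -> W) x :
  [locally [lipschitz f y | y in setT]] -> exists2 k, 0 < k &
    exists2 d, 0 < d & forall y z, ball x d y -> ball x d z ->
      `|f y - f z| <= k * `|y - z|.
Proof.
move=> /(_ (x, x) (conj Logic.I Logic.I)).
rewrite setXTT => -[M [Mreal]] /(_ (Num.max M 0 + 1)).
have Mlt : M < Num.max M 0 + 1 by rewrite ltr_pwDr// le_max lexx.
move=> /(_ Mlt); rewrite /dominated_by/= => /nbhs_ballP[d /= d0 H].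
exists (Num.max M 0 + 1); first by rewrite ltr_pwDr// le_max lexx orbT.
by exists d => // y z xy xz; apply: (H (y, z)).
Qed.

Lemma locally_lipschitz_continuous (f : V -> W) :
  [locally [lipschitz f y | y in setT]] -> continuous f.
Proof.
move=> fl x; have [k k0 [d d0 H]] := locally_lipschitz_near x fl.
apply/cvgrPdist_le => e e0; apply/nbhs_ballP.
exists (Num.min d (e / k)) => [|y]; first by rewrite /= lt_min d0 divr_gt0.
rewrite -ball_normE/= lt_min ltr_pdivlMr// => /andP[xd xe].
rewrite (le_trans (H _ _ _ _))//; [exact: ballxx|by rewrite -ball_normE|].
by rewrite mulrC ltW.
Qed.

End LocallyLipschitz.

Section Fields.
Context {R : realType} {m n : nat}.
Implicit Types (p : 'rV[R]_m * 'rV[R]_n).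
Variables (h : 'rV[R]_n -> R) (P : 'M[R]_n).
Variables (f : 'rV[R]_m * 'rV[R]_n -> 'rV[R]_n).
Hypothesis h_diff : forall x, differentiable h x.
Hypothesis h_C1 : continuous (gradient h).
Hypothesis grad_neq0 : forall x, h x = 0 -> gradient h x != 0.
Hypothesis P_posdef : posdef P.
Hypothesis f_cont : continuous f.

Lemma f_cbfE alpha p : 0 <= h p.2 -> 0 <= alpha ->
  f_cbf h P f alpha p =
  halfspace_proj P (gradient h p.2) (alpha * h p.2) (f p).
Proof.
move=> hp a0; rewrite /f_cbf argmin_halfspace//; last by right; rewrite mulr_ge0.
exact: xget_unique.
Qed.

(** Puts the PDS in the same closed form as the CBF field, with normal [active_normal] and offset 0
    instead of [gradient h] and [alpha * h]. *)
Lemma pds_fieldP g p v : pds_field h P f g p v <->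
  [/\ 0 <= h p.2, v.1 = g p &
      v.2 = halfspace_proj P (active_normal h p.2) 0 (f p)].
Proof.
rewrite /pds_field/= /superlevel/=; split=> -[hp v1 v2]; split => //.
  by move: v2; rewrite tangent_cone_superlevel// argmin_halfspace//; right.
by rewrite tangent_cone_superlevel// argmin_halfspace//; right.
Qed.

Lemma halfspace_projE a b v :
  halfspace_proj P a b v = v + - Num.min 0 (dotv a v + b) *: pnormal P a.
Proof. by rewrite /halfspace_proj scaleNr. Qed.

(** Uniformity in [alpha]: on the superlevel set [alpha * h] is nonnegative and can only shrink the
    multiplier. *)
Lemma cbf_decomposition alpha p : 0 <= h p.2 -> 0 <= alpha ->
  exists2 l, 0 <= l <= `|lie f h p| &
    halfspace_proj P (gradient h p.2) (alpha * h p.2) (f p) =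
    f p + l *: pnormal P (gradient h p.2).
Proof.
move=> hp a0; exists (- Num.min 0 (lie f h p + alpha * h p.2)).
  rewrite oppr_ge0 ge_min lexx/= lerNl le_min lerNl oppr0 normr_ge0/=.
  by have := mulr_ge0 a0 hp; have := ler_norm (- lie f h p); rewrite normrN; lra.
exact: halfspace_projE.
Qed.

Lemma cvg_gradient p : gradient h q.2 @[q --> p] --> gradient h p.2.
Proof. by apply: cvg_comp; [exact: cvg_snd|exact: h_C1]. Qed.

Lemma cvg_lie p : lie f h q @[q --> p] --> lie f h p.
Proof. by apply: cvg_dotv; [exact: cvg_gradient|exact: f_cont]. Qed.

Lemma cvg_h p : h q.2 @[q --> p] --> h p.2.
Proof. by apply: cvg_comp; [exact: cvg_snd|exact: continuous_h]. Qed.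

Lemma cvg_pnormal p : gradient h p.2 != 0 ->
  pnormal P (gradient h q.2) @[q --> p] --> pnormal P (gradient h p.2).
Proof.
move=> g0; have cQ : gradient h q.2 *m invmx P @[q --> p] -->
    gradient h p.2 *m invmx P.
  exact: cvg_comp (@cvg_gradient p) (@mulmx_continuous _ _ (invmx P) _).
apply: cvgZ; last exact: cQ.
apply: cvgV; first by rewrite gt_eqF// dotv_invmx_gt0.
by apply: cvg_dotv; [exact: cvg_gradient|exact: cQ].
Qed.

Lemma cbf_near_interior p : 0 < h p.2 -> exists A, \forall q \near p,
  forall alpha, A <= alpha ->
  halfspace_proj P (gradient h q.2) (alpha * h q.2) (f q) = f q.
Proof.
(* Near [p], [h] exceeds [h p.2 / 2] and the Lie derivative is bounded by [|lie f h p| + 1], so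
   beyond this threshold the constraint is inactive. *)
move=> hp; exists ((`|lie f h p| + 1) / (h p.2 / 2)).
near=> q; move=> alpha Aalpha.
have hq : h p.2 / 2 < h q.2.
  by near: q; apply: (cvgr_gt _ (@cvg_h p)); lra.
have lq : `|lie f h q| <= `|lie f h p| + 1.
  by near: q; apply: (cvgr_norm_le _ (@cvg_lie p)); lra.
rewrite /halfspace_proj -/(lie f h q) min_l ?scale0r ?subr0//.
have hp2 : 0 < h p.2 / 2 by lra.
move: Aalpha; rewrite ler_pdivrMr// => Aalpha.
have al0 : 0 <= alpha.
  by rewrite -(pmulr_lge0 _ hp2); have := normr_ge0 (lie f h p); lra.
have := ler_norm (- lie f h q); rewrite normrN.
by nra.
Unshelve. all: by end_near. Qed.

(** For [a != 0], the [P]-orthogonal projection on the hyperplane orthogonal to [a]; it kills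
    [pnormal P a]. *)
Definition tangential_part a v := v - dotv a v *: pnormal P a.

Lemma tangential_partD a u v :
  tangential_part a (u + v) = tangential_part a u + tangential_part a v.
Proof. by rewrite /tangential_part dotvDr scalerDl opprD addrACA. Qed.

Lemma tangential_partZ a k v : tangential_part a (k *: v) = k *: tangential_part a v.
Proof. by rewrite /tangential_part dotvZr -scalerA -scalerBr. Qed.

Lemma cvg_tangential_part T (F : set_system T) {FF : Filter F} a
    (u : T -> 'rV[R]_n) v :
  u x @[x --> F] --> v -> tangential_part a (u x) @[x --> F] --> tangential_part a v.
Proof.
move=> uv; apply: cvgB => //; apply: cvgZ; last exact: cvg_cst.
by apply: cvg_dotv => //; exact: cvg_cst.
Qed.

(** The correction is a bounded nonnegative multiple of a vector that tends to [pnormal P a] as [q]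
    tends to [p]. Whatever [alpha], its tangential part is thus small, and its product with [a] is
    nonnegative, since [dotv a] is near 1 on that vector. *)
Lemma cbf_near_boundary p e : h p.2 = 0 -> 0 < e ->
  let a := gradient h p.2 in
  \forall q \near p, forall alpha, 0 <= alpha -> 0 <= h q.2 ->
  let v := halfspace_proj P (gradient h q.2) (alpha * h q.2) (f q) in
  `|tangential_part a v - tangential_part a (f p)| <= e /\
  dotv a (f p) - e <= dotv a v.
Proof.
move=> hp e0 a; have a0 : a != 0 by exact: grad_neq0.
set B := `|lie f h p| + 1; have B0 : 0 < B by rewrite ltr_wpDl.
have cnu := cvg_pnormal a0.
have ctn : tangential_part a (pnormal P (gradient h q.2)) @[q --> p] -->
    tangential_part a (pnormal P a) by exact: cvg_tangential_part.
have ctf : tangential_part a (f q) @[q --> p] --> tangential_part a (f p).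
  by apply: cvg_tangential_part; exact: f_cont.
have cdn : dotv a (pnormal P (gradient h q.2)) @[q --> p] -->
    dotv a (pnormal P a) by apply: cvg_dotv; [exact: cvg_cst|exact: cnu].
have cdf : dotv a (f q) @[q --> p] --> dotv a (f p).
  by apply: cvg_dotv; [exact: cvg_cst|exact: f_cont].
have tn0 : tangential_part a (pnormal P a) = 0.
  by rewrite /tangential_part dotv_pnormal// scale1r subrr.
clear cnu; clearbody a.
near=> q; move=> alpha al0 hq.
have lq : `|lie f h q| <= B.
  by near: q; apply: (cvgr_norm_le _ (@cvg_lie p)); rewrite /B; lra.
have [l /andP[l0 lB] ->] := cbf_decomposition hq al0.
split.
  rewrite tangential_partD tangential_partZ addrAC.
  rewrite (le_trans (ler_normD _ _))// normrZ (ger0_norm l0).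
  have n1 : `|tangential_part a (f q) - tangential_part a (f p)| <= e / 2.
    by near: q; apply: (cvgr_distC_le _ _ ctf); rewrite divr_gt0.
  have : `|tangential_part a (pnormal P (gradient h q.2)) -
      tangential_part a (pnormal P a)| <= e / 2 / B.
    by near: q; apply: (cvgr_distC_le _ _ ctn); rewrite !divr_gt0.
  rewrite tn0 subr0 => n2.
  have : l * `|tangential_part a (pnormal P (gradient h q.2))| <= B * (e / 2 / B).
    by apply: ler_pM => //; exact: le_trans lB lq.
  by rewrite [B * _]mulrC divfK ?gt_eqF//; lra.
have n1 : dotv a (f p) - e < dotv a (f q).
  by near: q; apply: (cvgr_gt _ cdf); lra.
have n2 : 0 < dotv a (pnormal P (gradient h q.2)).
  by near: q; apply: (cvgr_gt _ cdn); rewrite dotv_pnormal.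
by rewrite dotvDr dotvZr; have := mulr_ge0 l0 (ltW n2); lra.
Unshelve. all: by end_near. Qed.

(** At a boundary point the gradient is nonzero, so the normal stays bounded nearby; at an interior
    point the constraint is inactive for large [alpha]. One [M] serves as threshold and as bound, so
    that a covering argument has a single number to enlarge. *)
Lemma cbf_near_bounded p : 0 <= h p.2 -> exists M, \forall q \near p,
  forall alpha, M <= alpha -> 0 <= h q.2 ->
  `|halfspace_proj P (gradient h q.2) (alpha * h q.2) (f q)| <= M.
Proof.
move=> hp; have [hp0|hp0] := eqVneq (h p.2) 0; last first.
  have [|A HA] := @cbf_near_interior p; first by rewrite lt_def hp0.
  exists (Num.max A (`|f p| + 1)); near=> q; move=> alpha.
  rewrite ge_max => /andP[Aal _] hq; rewrite (near HA q)//.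
  rewrite le_max; apply/orP; right.
  by near: q; apply: (cvgr_norm_le _ (@f_cont p)); lra.
set nu := pnormal P (gradient h p.2).
exists (`|f p| + 1 + (`|lie f h p| + 1) * (`|nu| + 1)).
near=> q; move=> alpha Mal hq.
have al0 : 0 <= alpha by apply: le_trans Mal; rewrite !addr_ge0// mulr_ge0// addr_ge0.
have [l /andP[l0 lB] ->] := cbf_decomposition hq al0.
rewrite (le_trans (ler_normD _ _))// normrZ (ger0_norm l0) lerD//.
  by near: q; apply: (cvgr_norm_le _ (@f_cont p)); lra.
rewrite ler_pM//.
  apply: (le_trans lB).
  by near: q; apply: (cvgr_norm_le _ (@cvg_lie p)); lra.
near: q; apply: (cvgr_norm_le _ (@cvg_pnormal p _)); last by rewrite -/nu; lra.
exact: grad_neq0.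
Unshelve. all: by end_near. Qed.

End Fields.

(** * Compactness and limits of trajectories *)

Section ArzelaAscoli.
Context {R : realType} {V : normedModType R}.

Lemma finite_times_nbhs (g : {ptws R -> V}) (J : seq R) e : 0 < e ->
  nbhs g [set f : {ptws R -> V} | forall t, t \in J -> `|f t - g t| < e].
Proof.
move=> e0; elim: J => [|t J IH]; first exact: filterE.
have Ht : nbhs g [set f : {ptws R -> V} | `|f t - g t| < e].
  have /= := @proj_continuous R (fun=> V) t g.
  move=> /(_ [set y | `|y - g t| < e]); apply.
  by apply/nbhs_ballP; exists e => // y; rewrite -ball_normE/= distrC.
apply: filterS (filterI Ht IH) => f [/= ft fJ] s.
by rewrite inE => /predU1P[->//|/fJ].
Qed.

Variables (K : set V) (T M : R) (psi : nat -> R -> V).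
Hypothesis K_compact : compact K.
Hypothesis psi_in : forall i t, K (psi i t).
Hypothesis psi_lip : forall i s t, `|psi i s - psi i t| <= M * `|s - t|.

(** A cluster point in the product topology, from Tychonoff's theorem; it only controls finitely
    many times at once. *)
Lemma pointwise_cluster : exists2 g : R -> V, (forall t, K (g t)) &
  forall J : seq R, forall e, 0 < e -> forall N, exists2 i, (N <= i)%N &
    forall t, t \in J -> `|psi i t - g t| < e.
Proof.
have tych := @tychonoff R (fun=> V) (fun=> K) (fun=> K_compact).
have PF : ProperFilter ((psi : nat -> {ptws R -> V}) @ \oo) by exact: fmap_proper_filter.
have [|g [Kg cg]] := tych _ PF; first by exists 0%N => // i _ t; exact: psi_in.
exists g => // J e e0 N.
have [|f [[i Ni <-] fJ]] := cg (psi @` [set i | (N <= i)%N]) _ _ (finite_times_nbhs g J e0).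
  by exists N => // i /= Ni; exists i.
by exists i.
Qed.

(** Closeness on a fine finite grid spreads to all of [[0, T]], because the functions share a
    Lipschitz constant. *)
Lemma lipschitz_subsequence : exists sigma : nat -> nat, exists g : R -> V,
  [/\ {homo sigma : i j / (i < j)%N}, forall t, K (g t),
      forall s t, `|g s - g t| <= M * `|s - t| &
      forall e, 0 < e -> exists N, forall k, (N <= k)%N -> forall t,
        0 <= t <= T -> `|psi (sigma k) t - g t| <= e].
Proof.
have [g Kg gcl] := pointwise_cluster.
have M0 : 0 <= M.
  have := le_trans (normr_ge0 _) (psi_lip 0 0 1).
  by rewrite sub0r normrN normr1 mulr1.
have glip s t : `|g s - g t| <= M * `|s - t|.
  apply/ler_addgt0Pl => e e0.
  have [|i _ H] := gcl [:: s; t] (e / 2) _ 0; first by rewrite divr_gt0.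
  have Hs := H s; have Ht := H t; rewrite !inE !eqxx orbT/= in Hs Ht.
  have -> : g s - g t = (g s - psi i s) + (psi i s - psi i t) + (psi i t - g t).
    by rewrite !subrKA.
  rewrite (le_trans (ler_normD _ _))//.
  have := ler_normD (g s - psi i s) (psi i s - psi i t).
  have := psi_lip i s t; have := Hs isT; have := Ht isT.
  by rewrite (distrC (psi i s)); lra.
have unif e N : 0 < e -> exists2 i, (N < i)%N & forall t, 0 <= t <= T ->
    `|psi i t - g t| <= e.
  (* With this mesh each function changes by at most [e / 4] between a time and the grid point below
     it; the error on the grid is another [e / 4]. *)
  move=> e0; pose d := e / (4 * (M + 1)).
  have M1 : 0 < M + 1 by lra.
  have d0 : 0 < d by rewrite divr_gt0// mulr_gt0.
  have Md : M * d <= e / 4.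
    have -> : e / 4 = d * (M + 1) by rewrite /d invfM mulrA divfK// gt_eqF.
    by nra.
  pose J := [seq j%:R * d | j <- iota 0 (Num.truncn (T / d)).+1].
  have [|i Ni H] := gcl J (e / 4) _ N.+1; first by rewrite divr_gt0.
  exists i => // t /andP[t0 tT].
  set j := Num.truncn (t / d).
  have td0 : 0 <= t / d by rewrite divr_ge0// ltW.
  have jJ : j%:R * d \in J.
    apply/mapP; exists j => //; rewrite mem_iota/= add0n ltnS /j.
    by apply: le_truncn; rewrite ler_pM2r// invr_gt0.
  have /andP[j1 j2] := truncn_itv td0; rewrite -/j in j1 j2.
  have jt : `|t - j%:R * d| <= d.
    rewrite ler_pdivlMr// in j1; rewrite ltr_pdivrMr// in j2.
    by rewrite -natr1 in j2; rewrite ger0_norm; lra.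
  have Hj := H _ jJ; have p1 := psi_lip i t (j%:R * d); have p2 := glip (j%:R * d) t.
  have -> : psi i t - g t = (psi i t - psi i (j%:R * d)) +
      (psi i (j%:R * d) - g (j%:R * d)) + (g (j%:R * d) - g t).
    by rewrite !subrKA.
  rewrite (le_trans (ler_normD _ _))//.
  have := ler_normD (psi i t - psi i (j%:R * d)) (psi i (j%:R * d) - g (j%:R * d)).
  rewrite (distrC _ t) in p2.
  have : M * `|t - j%:R * d| <= M * d by rewrite ler_wpM2l.
  by lra.
have /choice[c cP] : forall q : nat * nat, exists i, (q.2 < i)%N /\
    forall t, 0 <= t <= T -> `|psi i t - g t| <= q.1.+1%:R^-1.
  by move=> [k N]; have [|i] := unif k.+1%:R^-1 N; [rewrite invr_gt0|exists i].
(* Each index is chosen beyond the previous one, and [psi (sigma k)] approximates [g] within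
   [1 / (k + 1)]. *)
pose sigma := fix s k := if k is k'.+1 then c (k, s k') else c (0, 0)%N.
exists sigma, g; split => //.
  apply: homo_ltn; first exact: ltn_trans.
  by move=> k; have [] := cP (k.+1, sigma k).
move=> e e0; exists (Num.truncn e^-1) => k Nk t tT.
have [q ->] : exists N, sigma k = c (k, N).
  by case: k {Nk} => [|k]; [exists 0%N|exists (sigma k)].
have [_ /(_ _ tT)/le_trans] := cP (k, q); apply => /=.
rewrite -[leRHS]invrK lef_pV2 ?posrE ?invr_gt0//.
have := truncnS_gt e^-1 => /ltW/le_trans; apply.
by rewrite ler_nat ltnS.
Qed.

End ArzelaAscoli.

(** * Mean value inequalities and density points *)

Section AbsolutelyContinuous.
Context {R : realType}.

Lemma aeS (Q Q' : R -> Prop) : (forall x, Q x -> Q' x) ->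
  {ae lebesgue_measure, forall x : R, Q x} ->
  {ae lebesgue_measure, forall x : R, Q' x}.
Proof.
move=> QQ' [N [mN N0 sN]]; exists N; split => // x nQ'; apply: sN => /= Qx.
exact/nQ'/QQ'.
Qed.

Lemma aeI (Q Q' : R -> Prop) :
  {ae lebesgue_measure, forall x : R, Q x} ->
  {ae lebesgue_measure, forall x : R, Q' x} ->
  {ae lebesgue_measure, forall x : R, Q x /\ Q' x}.
Proof.
move=> q q'; have := negligibleU q q'; apply: negligibleS => x /= /not_andP[|];
  by [left|right].
Qed.

Lemma lipschitz_abs_continuous {V : normedModType R} (phi : R -> V) a b M :
  (forall s t, `|phi s - phi t| <= M * `|s - t|) -> abs_continuous a b phi.
Proof.
move=> lip e e0; exists (e / (`|M| + 1)); first by rewrite divr_gt0// ltr_wpDl.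
move=> N s t st _; rewrite ltr_pdivlMr; last by rewrite ltr_wpDl.
apply: le_lt_trans; rewrite mulr_suml; apply: ler_sum => i _.
have [_ [st0 _]] := st i; rewrite (le_trans (lip _ _))//.
rewrite ger0_norm ?subr_ge0// mulrC ler_wpM2l ?subr_ge0//.
by have := ler_norm M; lra.
Qed.

Lemma abs_continuousS {V : normedModType R} (phi : R -> V) a b c d :
  a <= c -> d <= b -> abs_continuous a b phi -> abs_continuous c d phi.
Proof.
move=> ac db H e /H[r r0 {}H]; exists r => // N s t st; apply: H => i.
have [? [? ?]] := st i; split; first exact: le_trans ac _.
by split => //; exact: le_trans db.
Qed.

(* For N the norm this is the mean value inequality, for N the opposite on R a
   one-sided version of it. *)
Lemma abs_continuous_mean {V W : normedModType R} (N : W -> R) (B : V -> W)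
    (phi : R -> V) a b K w c :
  (forall x y, N (x + y) <= N x + N y) ->
  (forall t x, 0 <= t -> N (t *: x) = t * N x) ->
  (forall x, N x <= `|x|) ->
  (forall x y, B (x + y) = B x + B y) ->
  (forall t x, B (t *: x) = t *: B x) ->
  (forall x, `|B x| <= K * `|x|) ->
  a <= b -> 0 <= K -> abs_continuous a b phi ->
  {ae lebesgue_measure, forall t : R, t \in `[a, b] ->
    derivable phi t 1 /\ N (B (derive1 phi t) - w) <= c} ->
  N (B (phi b - phi a) - (b - a) *: w) <= c * (b - a).
Proof.
move=> ND NZ Nb BD BZ BK ab K0 ac dphi.
rewrite -subr_le0.
have BN x : B (- x) = - B x by rewrite -scaleN1r BZ scaleN1r.
pose psi t := B (phi t) - t *: w.
have psiE s u : B (phi u - phi s) - (u - s) *: w = psi u - psi s.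
  by rewrite BD BN (increment_drift (B \o phi)).
(* [Phi] is the excess of the drift-corrected increment over its bound; it is subadditive because
   [N] is. *)
apply: (abs_continuous_interval (K := K + `|w| + `|c|) (Phi := fun s u =>
  N (B (phi u - phi s) - (u - s) *: w) - c * (u - s)) _ _ ac) => //.
- by rewrite !addr_ge0.
- move=> s t u _ _ _ _; rewrite !psiE.
  have -> : psi u - psi s = (psi u - psi t) + (psi t - psi s) by rewrite subrKA.
  by have := ND (psi u - psi t) (psi t - psi s); lra.
- move=> s u _ su _.
  have := Nb (B (phi u - phi s) - (u - s) *: w).
  have := ler_normB (B (phi u - phi s)) ((u - s) *: w).
  have := BK (phi u - phi s); rewrite normrZ (@ger0_norm _ (u - s)) ?subr_ge0//.
  have : - c * (u - s) <= `|c| * (u - s).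
    by rewrite ler_wpM2r ?subr_ge0// -normrN ler_norm.
  have : 0 <= (`|w| + `|c|) * `|phi u - phi s| by rewrite mulr_ge0// addr_ge0.
  have : 0 <= K * (u - s) by rewrite mulr_ge0// subr_ge0.
  by lra.
- apply: aeS dphi => t dt /dt[drv Nt] e e0.
  have K1 : 0 < K + 1 by lra.
  have [|d d0 H] := derivable_straddle drv (e := e / (K + 1)).
    by rewrite divr_gt0.
  exists d => // s u _ st tu _ us.
  have su : 0 <= u - s by lra.
  have := H s u st tu us; set r := _ - _ *: _ => rle.
  have -> : B (phi u - phi s) - (u - s) *: w =
      (u - s) *: (B (derive1 phi t) - w) + B r.
    have -> : B r = B (phi u - phi s) - (u - s) *: B (derive1 phi t).
      by rewrite /r [LHS]BD BN BZ.
    by rewrite scalerBr [RHS]addrC subrKA.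
  have := ND ((u - s) *: (B (derive1 phi t) - w)) (B r); rewrite NZ//.
  have := Nb (B r); have := BK r.
  have : (u - s) * N (B (derive1 phi t) - w) <= (u - s) * c by rewrite ler_wpM2l.
  have : K * `|r| <= K * (e / (K + 1) * (u - s)) by rewrite ler_wpM2l.
  have E : e / (K + 1) * (K + 1) = e by rewrite divfK// gt_eqF.
  have E2 : 0 <= e / (K + 1) * (u - s) by rewrite mulr_ge0// divr_ge0// ltW.
  have : e * (u - s) = e / (K + 1) * (u - s) * (K + 1) by rewrite mulrAC E.
  by lra.
Qed.

(** Let [rho] be the distance from [s] to the point. If [A] missed the ball of radius [e * rho]
    around [s], it would miss the fraction [e / (1 + e)] of the ball of radius [(1 + e) * rho]
    around the point, against Lebesgue's density theorem. *)
Lemma density_points (A : set R) : measurable A ->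
  {ae lebesgue_measure, forall t : R, A t -> forall e, 0 < e ->
    exists2 d, 0 < d & forall s, `|s - t| < d ->
      exists2 r, A r & `|r - s| <= e * `|s - t|}.
Proof.
move=> mA; apply: aeS (lebesgue_density mA) => x + Ax e0 e00.
rewrite indicE mem_set//= => /fine_cvgP[_] /cvgrPdist_lt cv.
(* With [e <= 1] and [rho < d / 2], the radius [(1 + e) * rho] stays below [d]. *)
pose e := Num.min e0 1.
have e_gt0 : 0 < e by rewrite lt_min e00 ltr01.
have [|d /= d0 H] := cv (e / (1 + e)); first by rewrite divr_gt0// addr_gt0.
exists (d / 2); first by rewrite divr_gt0.
move=> s sx; have [->|sx0] := eqVneq s x.
  by exists x => //; rewrite !subrr !normr0 mulr0.
have rho0 : 0 < `|s - x| by rewrite normr_gt0 subr_eq0.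
set rho := `|s - x| in sx rho0 *.
suff [r Ar rs] : exists2 r, A r & `|r - s| <= e * rho.
  exists r => //; apply: (le_trans rs); apply: ler_wpM2r; first exact: ltW.
  by rewrite ge_min lexx.
apply: contrapT => noA.
have e1 : e <= 1 by rewrite ge_min lexx orbT.
pose r := (1 + e) * rho; have r0 : 0 < r by rewrite mulr_gt0// addr_gt0.
have rd : r < d by rewrite /r; nra.
have := H r; rewrite /ball_/= sub0r normrN gtr0_norm// => /(_ rd r0).
have er0 : 0 <= e * rho by rewrite mulr_ge0// ltW.
have dis : A `&` ball x r `&` ball s (e * rho) = set0.
  rewrite -subset0 => y [[Ay _]]; rewrite /ball/= => sy; apply: noA; exists y => //.
  by rewrite distrC ltW.
have sub : ball s (e * rho) `<=` ball x r.
  move=> y; rewrite /ball/= => sy; rewrite (le_lt_trans (ler_distD s _ _))// distrC.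
  by rewrite -/rho /r mulrDl mul1r ltrD2l.
have mB : measurable (ball x r : set R) by exact: measurable_ball.
have mB' : measurable (ball s (e * rho) : set R) by exact: measurable_ball.
have mAB : measurable (A `&` ball x r) by exact: measurableI.
have Hle : (lebesgue_measure (A `&` ball x r) + (e * rho *+ 2)%:E <= (r *+ 2)%:E)%E.
  rewrite -(lebesgue_measure_ball s er0) -(lebesgue_measure_ball x (ltW r0)).
  rewrite -measureU//; apply: le_measure; rewrite ?inE//; first exact: measurableU.
  by rewrite subUset; split => // y [].
have fin : lebesgue_measure (A `&` ball x r) \is a fin_num.
  rewrite ge0_fin_numE//; apply: le_lt_trans (ltry (r *+ 2)).
  by apply: le_trans Hle; rewrite leeDl// lee_fin mulrn_wge0.
rewrite lebesgue_measure_ball ?ltW// -(fineK fin).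
move: Hle; rewrite -(fineK fin) -EFinD lee_fin; set a := fine _ => Hle.
rewrite inver mulrn_eq0/= gt_eqF// -EFinM/=.
have a1 : a / (r *+ 2) <= 1 - e / (1 + e).
  rewrite ler_pdivrMr ?mulrn_wgt0// mulrBl mul1r.
  have -> : e / (1 + e) * (r *+ 2) = e * rho *+ 2.
    by rewrite mulrnAr /r mulrA divfK// gt_eqF// addr_gt0.
  by rewrite lerBrDr.
have := ler_norm (1 - a / (r *+ 2)); lra.
Qed.

End AbsolutelyContinuous.

(** * Derivative of a uniform limit of trajectories *)

Section LimitTrajectory.
Context {R : realType} {m n : nat}.
Variables (h : 'rV[R]_n -> R) (P : 'M[R]_n).
Variables (f : 'rV[R]_m * 'rV[R]_n -> 'rV[R]_n).
Variables (g : 'rV[R]_m * 'rV[R]_n -> 'rV[R]_m).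
Hypothesis h_diff : forall x, differentiable h x.
Hypothesis h_C1 : continuous (gradient h).
Hypothesis grad_neq0 : forall x, h x = 0 -> gradient h x != 0.
Hypothesis P_posdef : posdef P.
Hypothesis f_cont : continuous f.
Hypothesis g_cont : continuous g.

Let cbf al p : 'rV[R]_m * 'rV[R]_n :=
  (g p, halfspace_proj P (gradient h p.2) (al * h p.2) (f p)).

Variables (alpha : nat -> R) (T M : R).
Variables (phi_ : nat -> R -> 'rV[R]_m * 'rV[R]_n).
Variables (psi : R -> 'rV[R]_m * 'rV[R]_n).
Hypothesis alpha_ge0 : forall i, 0 <= alpha i.
Hypothesis alpha_infty : alpha i @[i --> \oo] --> +oo.
Hypothesis phi_ac : forall i, abs_continuous 0 T (phi_ i).
Hypothesis phi_de : forall i, {ae lebesgue_measure, forall t : R,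
  t \in `[0, T] -> derivable (phi_ i) t 1 /\
    derive1 (phi_ i) t = cbf (alpha i) (phi_ i t)}.
Hypothesis phi_S : forall i t, 0 <= t <= T -> 0 <= h (phi_ i t).2.
Hypothesis M_ge0 : 0 <= M.
Hypothesis psi_lip : forall s t, `|psi s - psi t| <= M * `|s - t|.
Hypothesis psi_S : forall t, 0 <= h (psi t).2.
Hypothesis phi_psi : forall e, 0 < e -> exists I, forall i, (I <= i)%N ->
  forall t, 0 <= t <= T -> `|phi_ i t - psi t| <= e.

(** At times near [t0] and for large [i], [phi_ i] stays in the neighbourhood where the field
    estimate holds, and [alpha i >= A]. So [abs_continuous_mean] bounds its increments, and [i]
    tends to infinity. *)
Lemma limit_mean {W : normedModType R} (N : W -> R)
    (B : 'rV[R]_m * 'rV[R]_n -> W) K w c A t0 :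
  (forall x y, N (x + y) <= N x + N y) ->
  (forall t x, 0 <= t -> N (t *: x) = t * N x) ->
  (forall x, N x <= `|x|) ->
  (forall x y, B (x + y) = B x + B y) ->
  (forall t x, B (t *: x) = t *: B x) ->
  (forall x, `|B x| <= K * `|x|) -> 0 <= K ->
  (\forall q \near psi t0, forall al, 0 <= al -> A <= al -> 0 <= h q.2 ->
    N (B (cbf al q) - w) <= c) ->
  exists2 d, 0 < d & forall s u, 0 <= s -> s <= u -> u <= T ->
    `|s - t0| < d -> `|u - t0| < d ->
    N (B (psi u - psi s) - (u - s) *: w) <= c * (u - s).
Proof.
move=> ND NZ Nb BD BZ BK K0 /nbhs_ballP[r /= r0 Hr].
have M1 : 0 < M + 1 by rewrite ltr_wpDl.
(* Half of [r] is for the motion of [psi], half for the distance from [phi_ i] to [psi]. *)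
exists (r / 2 / (M + 1)); first by rewrite !divr_gt0.
move=> s u s0 su uT; rewrite !ltr_pdivlMr// => sd ud.
have r20 : 0 < r / 2 by lra.
have [I HI] := phi_psi r20.
have [I' _ HI'] : \forall i \near \oo, A <= alpha i by exact: (cvgry_ge alpha_infty).
have near_r i t : (I <= i)%N -> s <= t <= u -> ball (psi t0) r (phi_ i t).
  move=> Ii /andP[st tu]; rewrite -ball_normE/= distrC.
  have -> : phi_ i t - psi t0 = (phi_ i t - psi t) + (psi t - psi t0) by rewrite subrKA.
  rewrite (le_lt_trans (ler_normD _ _))//.
  have tT : 0 <= t <= T by rewrite (le_trans s0)// (le_trans tu).
  have := HI _ Ii _ tT; have := psi_lip t t0.
  have : `|t - t0| * (M + 1) < r / 2.
    have [tt|tt] := leP t t0.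
      rewrite ler0_norm; last by lra.
      by move: sd; rewrite ler0_norm; [nra|lra].
    rewrite gtr0_norm; last by lra.
    by move: ud; rewrite gtr0_norm; [nra|lra].
  by have := normr_ge0 (t - t0); lra.
have mean i : (I <= i)%N -> (I' <= i)%N ->
    N (B (phi_ i u - phi_ i s) - (u - s) *: w) <= c * (u - s).
  move=> Ii I'i; apply: (@abs_continuous_mean _ _ _ N B _ _ _ K) => //.
    exact: abs_continuousS (phi_ac i).
  apply: aeS (phi_de i) => t Ht; rewrite in_itv/= => /andP[st tu].
  have tT : 0 <= t <= T by rewrite (le_trans s0)// (le_trans tu).
  have [|dv ->] := Ht; first by rewrite in_itv.
  split => //; apply: Hr => //; [by apply: near_r; rewrite ?st|exact: HI'|exact: phi_S].
apply/ler_addgt0Pl => e e0.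
have K1 : 0 < 2 * K + 1 by lra.
have eK : 0 < e / (2 * K + 1) by rewrite divr_gt0.
have [J HJ] := phi_psi eK.
pose i := maxn J (maxn I I').
have Hi := mean i ltac:(by rewrite /i !leq_max leqnn !orbT)
  ltac:(by rewrite /i !leq_max leqnn !orbT).
have Hu := HJ i ltac:(by rewrite /i leq_max leqnn) u ltac:(by rewrite uT (le_trans s0)).
have Hs := HJ i ltac:(by rewrite /i leq_max leqnn) s ltac:(by rewrite s0 (le_trans su)).
set x := phi_ i u - phi_ i s in Hi.
pose y := (psi u - psi s) - x.
have -> : psi u - psi s = x + y by rewrite /y addrCA subrr addr0.
have yle : `|y| <= e / (2 * K + 1) + e / (2 * K + 1).
  have -> : y = (phi_ i s - psi s) - (phi_ i u - psi u).
    by rewrite /y /x !opprB addrACA [RHS]addrACA [phi_ i s + _]addrC.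
  by rewrite (le_trans (ler_normB _ _))// lerD.
rewrite BD addrAC.
have := ND (B x - (u - s) *: w) (B y); have := Nb (B y); have := BK y.
have : K * `|y| <= K * (e / (2 * K + 1) + e / (2 * K + 1)) by rewrite ler_wpM2l.
have : e / (2 * K + 1) * (2 * K + 1) = e by rewrite divfK// gt_eqF.
by lra.
Qed.

Lemma limit_expansion {W : normedModType R}
    (B : 'rV[R]_m * 'rV[R]_n -> W) K w A t0 :
  (forall x y, B (x + y) = B x + B y) ->
  (forall t x, B (t *: x) = t *: B x) ->
  (forall x, `|B x| <= K * `|x|) -> 0 <= K -> 0 < t0 < T ->
  (forall e, 0 < e ->
    \forall q \near psi t0, forall al, 0 <= al -> A <= al -> 0 <= h q.2 ->
    `|B (cbf al q) - w| <= e) ->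
  forall e, 0 < e -> exists2 d, 0 < d & forall s, `|s - t0| < d ->
    `|B (psi s - psi t0) - (s - t0) *: w| <= e * `|s - t0|.
Proof.
move=> BD BZ BK K0 /andP[t00 t0T] Hn e e0.
have [] := @limit_mean W (fun x => `|x|) B K w e A t0 _ _ _ BD BZ BK K0 (Hn e e0) => //.
  exact: ler_normD.
  by move=> t x t_ge0; rewrite normrZ ger0_norm.
move=> d d0 H; exists (Num.min d (Num.min t0 (T - t0))).
  by rewrite !lt_min d0 t00 subr_gt0.
move=> s; rewrite !lt_min => /and3P[sd]; rewrite !ltr_norml => /andP[? _] /andP[_ ?].
have t0d : `|t0 - t0| < d by rewrite subrr normr0.
have [st|st] := leP s t0.
  have := H s t0 ltac:(lra) st ltac:(lra) sd t0d.
  rewrite (ler0_norm (_ : s - t0 <= 0)) ?subr_le0// opprB -normrN.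
  have BN x : B (- x) = - B x by rewrite -scaleN1r BZ scaleN1r.
  by rewrite opprD -BN -scaleNr !opprB.
have := H t0 s ltac:(lra) (ltW st) ltac:(lra) t0d sd.
by rewrite (gtr0_norm (_ : 0 < s - t0)) ?subr_gt0.
Qed.

Let fst_bound (x : 'rV[R]_m * 'rV[R]_n) : `|x.1| <= 1 * `|x|.
Proof. by rewrite mul1r prod_normE le_max lexx. Qed.

Let snd_bound (x : 'rV[R]_m * 'rV[R]_n) : `|x.2| <= 1 * `|x|.
Proof. by rewrite mul1r prod_normE le_max lexx orbT. Qed.

Lemma limit_expansion_fst t : 0 < t < T -> forall e, 0 < e ->
  exists2 d, 0 < d & forall s, `|s - t| < d ->
    `|(psi s - psi t).1 - (s - t) *: g (psi t)| <= e * `|s - t|.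
Proof.
move=> tT; apply: (@limit_expansion _ fst 1 (g (psi t)) 0) => // e e0.
near=> q; move=> al _ _ _ /=.
by near: q; apply: cvgr_distC_le => //; exact: g_cont.
Unshelve. all: by end_near. Qed.

Lemma limit_expansion_interior t : 0 < t < T -> 0 < h (psi t).2 ->
  forall e, 0 < e -> exists2 d, 0 < d & forall s, `|s - t| < d ->
    `|(psi s - psi t).2 - (s - t) *: f (psi t)| <= e * `|s - t|.
Proof.
move=> tT ht; have [A HA] := cbf_near_interior P h_diff h_C1 f_cont ht.
apply: (@limit_expansion _ snd 1 (f (psi t)) A) => // e e0.
near=> q; move=> al _ Aal _ /=; rewrite (near HA q)//.
by near: q; apply: cvgr_distC_le => //; exact: f_cont.
Unshelve. all: by end_near. Qed.

Let boundary_times := [set t | h (psi t).2 = 0].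

(** The property that [density_points] grants at almost every time; it is vacuous off [A]. *)
Definition density_point (A : set R) t := A t -> forall e, 0 < e ->
  exists2 d, 0 < d & forall s, `|s - t| < d ->
    exists2 r, A r & `|r - s| <= e * `|s - t|.

(* Near a density point, any s is close to some r with h (psi r) = 0, and the
   first order expansion of h compares psi r with psi t. *)
Lemma normal_expansion t : h (psi t).2 = 0 -> density_point boundary_times t ->
  forall e, 0 < e -> exists2 d, 0 < d & forall s, `|s - t| < d ->
    `|dotv (gradient h (psi t).2) (psi s - psi t).2| <= e * `|s - t|.
Proof.
move=> ht dt e e0; set a := gradient h (psi t).2.
have M1 : 0 < M + 1 by rewrite ltr_wpDl.
pose C := n%:R * `|a| * M + 1.
have C0 : 0 < C by rewrite /C ltr_wpDl// !mulr_ge0.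
(* Since [|r - t| <= 2 * |s - t|], [psi] moves by at most [2 * M * |s - t|] from [t] to [r], and the
   remainder is at most [e / 2 * |s - t|]. *)
have [|d1 d10 H1] := gradient_expansion h_diff (psi t).2 (e := e / (4 * (M + 1))).
  by rewrite divr_gt0// mulr_gt0.
(* The bound 1 gives [|r - t| <= 2 * |s - t|]; the other one makes the increment of [psi] between
   [r] and [s] contribute at most [e / 2 * |s - t|]. *)
have [||d2 d20 H2] := dt _ (Num.min 1 (e / (2 * C))) => //.
  by rewrite lt_min ltr01 divr_gt0// mulr_gt0.
exists (Num.min d2 (d1 / (2 * (M + 1)))).
  by rewrite lt_min d20 divr_gt0// mulr_gt0.
move=> s; rewrite lt_min ltr_pdivlMr; last by rewrite mulr_gt0.
move=> /andP[sd2 sd1]; have [r /= hr rs] := H2 _ sd2.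
have r1 : `|r - s| <= `|s - t|.
  by rewrite (le_trans rs)// -[leRHS]mul1r ler_wpM2r// ge_min lexx.
have r2 : `|r - s| <= e / (2 * C) * `|s - t|.
  by rewrite (le_trans rs)// ler_wpM2r// ge_min lexx orbT.
have rt : `|r - t| <= 2 * `|s - t|.
  by have := ler_distD s r t; lra.
have snd_lip u v : `|(psi u - psi v).2| <= M * `|u - v|.
  by apply: le_trans (psi_lip u v); rewrite -[leRHS]mul1r; exact: snd_bound.
have E1 : `|(psi r).2 - (psi t).2| <= M * (2 * `|s - t|).
  by rewrite (le_trans (snd_lip r t))// ler_wpM2l.
have st0 := normr_ge0 (s - t).
have := H1 (psi r).2; rewrite hr ht subrr sub0r normrN -/a => /(_ _) H1r.
have {}H1r : `|dotv a ((psi r).2 - (psi t).2)| <= e / 2 * `|s - t|.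
  apply: le_trans (H1r _) _; first by nra.
  have E : e / (4 * (M + 1)) * (2 * (M + 1)) = e / 2.
    by field; rewrite gt_eqF.
  apply: (@le_trans _ _ (e / (4 * (M + 1)) * (M * (2 * `|s - t|)))).
    by rewrite ler_wpM2l// divr_ge0 ?ltW// mulr_gt0.
  rewrite -E -[leRHS]mulrA ler_wpM2l//; first by rewrite divr_ge0 ?ltW// mulr_gt0.
  by nra.
have H3 : `|dotv a (psi s - psi r).2| <= e / 2 * `|s - t|.
  rewrite (le_trans (dotv_le _ _))//.
  apply: (@le_trans _ _ (n%:R * `|a| * (M * (e / (2 * C) * `|s - t|)))).
    rewrite ler_wpM2l ?mulr_ge0// (le_trans (snd_lip s r))// distrC.
    by rewrite ler_wpM2l.
  rewrite !mulrA ler_wpM2r//.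
  apply: (@le_trans _ _ (C * (e / (2 * C)))); last first.
    by rewrite (_ : C * (e / (2 * C)) = e / 2)//; field; rewrite gt_eqF.
  rewrite -[leLHS]mulrA ler_wpM2r//; first by rewrite divr_ge0 ?ltW// mulr_gt0.
  by rewrite /C; lra.
have := ler_normD (dotv a (psi s - psi r).2) (dotv a ((psi r).2 - (psi t).2)).
rewrite -dotvDr /= subrKA => /le_trans; apply.
by lra.
Qed.

(** Split the increment along [pnormal P a]: the tangential part follows the fields, by
    [cbf_near_boundary], and the normal part is negligible, by [normal_expansion]. *)
Lemma limit_expansion_boundary t : 0 < t < T -> h (psi t).2 = 0 ->
  density_point boundary_times t -> forall e, 0 < e ->
  exists2 d, 0 < d & forall s, `|s - t| < d ->
    `|(psi s - psi t).2 -
      (s - t) *: tangential_part P (gradient h (psi t).2) (f (psi t))| <=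
    e * `|s - t|.
Proof.
move=> tT ht dt e e0; set a := gradient h (psi t).2.
have tnD u v := tangential_partD P a u v.
have [C C0 HC] : exists2 C, 0 <= C & forall x : 'rV[R]_m * 'rV[R]_n,
    `|tangential_part P a x.2| <= C * `|x|.
  exists (1 + n%:R * `|a| * `|pnormal P a|) => [|x]; first by rewrite addr_ge0// !mulr_ge0.
  rewrite (le_trans (ler_normB _ _))// normrZ mulrDl.
  rewrite lerD ?snd_bound// mulrAC ler_wpM2r//.
  rewrite (le_trans (dotv_le _ _))// ler_wpM2l ?mulr_ge0//.
  by rewrite -[leRHS]mul1r snd_bound.
have Hb := cbf_near_boundary h_C1 grad_neq0 P_posdef f_cont ht.
have n1 : 0 < `|pnormal P a| + 1 by rewrite ltr_wpDl.
have [||||d1 d10 H1] := @limit_expansion _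
   (fun x => tangential_part P a x.2) C (tangential_part P a (f (psi t))) 0 t
   _ _ HC C0 tT _ (e / 2).
- by move=> x y; rewrite -tnD.
- by move=> k x; rewrite -tangential_partZ.
- move=> e' e'0; apply: filterS (Hb _ e'0) => q Hq al al0 _ hq.
  by have [] := Hq al al0 hq.
- by rewrite divr_gt0.
have [|d2 d20 H2] := normal_expansion ht dt (e := e / 2 / (`|pnormal P a| + 1)).
  by rewrite !divr_gt0.
exists (Num.min d1 d2) => [|s]; first by rewrite lt_min d10.
rewrite lt_min => /andP[/H1 {}H1 /H2 {}H2]; rewrite -/a in H2.
set x := (psi s - psi t).2 in H1 H2 *.
have -> : x = tangential_part P a x + dotv a x *: pnormal P a.
  by rewrite /tangential_part subrK.
rewrite addrAC (le_trans (ler_normD _ _))// normrZ.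
have st0 := normr_ge0 (s - t).
have : `|dotv a x| * `|pnormal P a| <=
    e / 2 / (`|pnormal P a| + 1) * `|s - t| * (`|pnormal P a| + 1).
  by apply: ler_pM => //; lra.
rewrite mulrAC divfK ?gt_eqF//.
by lra.
Qed.

(** The fields push along [a] at a rate of nearly [dotv a (f (psi t))] or more, because the
    corrections point inwards; but the component of the limit along [a] has derivative 0 at [t]. *)
Lemma limit_outward t : 0 < t < T -> h (psi t).2 = 0 ->
  density_point boundary_times t -> dotv (gradient h (psi t).2) (f (psi t)) <= 0.
Proof.
move=> tT ht dt; set a := gradient h (psi t).2.
apply/ler_addgt0Pl => e e0; rewrite addr0.
have e20 : 0 < e / 2 by rewrite divr_gt0.
have Hb := cbf_near_boundary h_C1 grad_neq0 P_posdef f_cont ht e20.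
(* Taking the opposite for [N] turns the lower bound on the rate into an upper bound. *)
have [||||||||d1 d10 H1] := @limit_mean R (fun x => - x) (fun x => dotv a x.2)
   (n%:R * `|a|) 0 (- (dotv a (f (psi t)) - e / 2)) 0 t.
- by move=> x y; rewrite opprD.
- by move=> k x _; rewrite -mulrN.
- by move=> x; rewrite -normrN ler_norm.
- by move=> x y; rewrite -dotvDr.
- by move=> k x; rewrite -[RHS]dotvZr.
- move=> x; rewrite (le_trans (dotv_le _ _))// ler_wpM2l ?mulr_ge0//.
  by rewrite -[leRHS]mul1r snd_bound.
- by rewrite mulr_ge0.
- apply: filterS Hb => q Hq al al0 _ hq.
  by have [_] := Hq al al0 hq; rewrite subr0 lerN2.
have [d2 d20 H2] := normal_expansion ht dt e20.
have /andP[t0 tT'] := tT.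
pose r := Num.min (Num.min d1 d2) (T - t) / 2.
have r0 : 0 < r by rewrite divr_gt0// !lt_min d10 d20 subr_gt0.
have m0 : 0 < Num.min (Num.min d1 d2) (T - t) by rewrite !lt_min d10 d20 subr_gt0.
have rm : r < Num.min (Num.min d1 d2) (T - t) by rewrite /r; lra.
move: rm; rewrite !lt_min => /andP[/andP[rd1 rd2] rT].
have tr : t + r - t = r by rewrite addrC addKr.
have := H1 t (t + r); rewrite subrr normr0 tr gtr0_norm//.
move=> /(_ (ltW t0) _ _ d10 rd1); rewrite lerDl ltW// => /(_ isT ltac:(lra)).
have := H2 (t + r); rewrite tr gtr0_norm// => /(_ rd2); rewrite -/a.
rewrite scaler0 subr0 ler_norml => /andP[h1 h2] h3.
have : (dotv a (f (psi t)) - e) * r <= 0 by lra.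
by rewrite pmulr_lle0//; lra.
Qed.

Lemma limit_derivative t : 0 < t < T -> density_point boundary_times t ->
  derivable psi t 1 /\ pds_field h P f g (psi t) (derive1 psi t).
Proof.
move=> tT dt.
pose v := halfspace_proj P (active_normal h (psi t).2) 0 (f (psi t)).
have Hv : forall e, 0 < e -> exists2 d, 0 < d & forall s, `|s - t| < d ->
    `|(psi s - psi t).2 - (s - t) *: v| <= e * `|s - t|.
  have [ht|ht] := eqVneq (h (psi t).2) 0; last first.
    have -> : v = f (psi t).
      rewrite /v /active_normal (negPf ht) /halfspace_proj dotv0l add0r minxx.
      by rewrite scale0r subr0.
    by apply: limit_expansion_interior => //; rewrite lt_def ht psi_S.
  (* By [limit_outward] the minimum in the projection is the scalar product itself. *)
  have -> : v = tangential_part P (gradient h (psi t).2) (f (psi t)).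
    rewrite /v /active_normal ht eqxx /halfspace_proj addr0 min_r//.
    exact: limit_outward.
  exact: limit_expansion_boundary.
have [|dpsi ->] := @expansion_derivable _ _ psi t (g (psi t), v).
  move=> e e0.
  have [d1 d10 H1] := limit_expansion_fst tT e0.
  have [d2 d20 H2] := Hv _ e0.
  exists (Num.min d1 d2) => [|s]; first by rewrite lt_min d10.
  rewrite lt_min => /andP[/H1 {}H1 /H2 {}H2].
  by rewrite prod_normE ge_max; apply/andP; split; [exact: H1|exact: H2].
split => //; apply/pds_fieldP => //.
Qed.

(** The exceptional times are the two endpoints and the non-density points of the set of boundary
    times, which is closed, hence measurable. *)
Lemma limit_is_solution : {ae lebesgue_measure, forall t : R, t \in `[0, T] ->
  derivable psi t 1 /\ pds_field h P f g (psi t) (derive1 psi t)}.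
Proof.
have mK : measurable boundary_times.
  apply: measurable_realfun.closed_measurable.
  apply: (@closed_comp _ _ (fun t => h (psi t).2) [set 0]); last exact: closed_eq.
  move=> t _; apply: (@cvg_comp _ _ _ psi (fun p => h p.2) _ (nbhs (psi t))).
    apply/cvgrPdist_le => e e0; apply/nbhs_ballP.
    have M1 : 0 < M + 1 by rewrite ltr_wpDl.
    exists (e / (M + 1)) => [|s]; first by rewrite /= divr_gt0.
    rewrite /ball/= ltr_pdivlMr// => ts; rewrite (le_trans (psi_lip t s))//.
    by have := normr_ge0 (t - s); nra.
  exact: cvg_h.
have ne c : {ae lebesgue_measure, forall t : R, t <> c}.
  exists [set c]; split => //; first exact: lebesgue_measure_set1.
  by move=> t /= /contrapT.
apply: aeS (aeI (density_points mK) (aeI (ne 0) (ne T))) => t [dt [t0 tT]].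
rewrite in_itv/= => /andP[t0' tT'].
apply: limit_derivative => //.
by rewrite !lt_neqAle t0' tT' !andbT eq_sym; apply/andP; split; apply/eqP.
Qed.

End LimitTrajectory.

(** * Extraction of a subsequence converging to a PDS solution *)

Section Subsequence.
Context {R : realType} {m n : nat}.
Variables (h : 'rV[R]_n -> R) (P : 'M[R]_n).
Variables (f : 'rV[R]_m * 'rV[R]_n -> 'rV[R]_n).
Variables (g : 'rV[R]_m * 'rV[R]_n -> 'rV[R]_m).
Hypothesis h_diff : forall x, differentiable h x.
Hypothesis h_C1 : continuous (gradient h).
Hypothesis grad_neq0 : forall x, h x = 0 -> gradient h x != 0.
Hypothesis P_posdef : posdef P.
Hypothesis f_cont : continuous f.
Hypothesis g_cont : continuous g.

(** The bounds of [cbf_near_bounded] hold near each point for all large [r]; the covering form of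
    compactness makes [r] uniform over [K]. *)
Lemma cbf_bounded (K : set ('rV[R]_m * 'rV[R]_n)) : compact K ->
  (forall q, K q -> 0 <= h q.2) -> exists2 M, 0 <= M &
  forall q al, K q -> M <= al ->
    `|(g q, halfspace_proj P (gradient h q.2) (al * h q.2) (f q))| <= M.
Proof.
move=> /compact_near_coveringP Kc KS.
have : \forall r \near +oo, K `<=` [set q | K q -> forall al, r <= al ->
    `|(g q, halfspace_proj P (gradient h q.2) (al * h q.2) (f q))| <= r].
  apply: Kc => p Kp.
  have [M HM] := cbf_near_bounded h_diff h_C1 grad_neq0 P_posdef f_cont (KS _ Kp).
  near=> q r; move=> /= Kq al ral.
  have rM : M <= r by near: r; apply: nbhs_pinfty_ge; exact: num_real.
  have rg : `|g p| + 1 <= r by near: r; apply: nbhs_pinfty_ge; exact: num_real.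
  rewrite prod_normE ge_max; apply/andP; split => /=.
    rewrite (le_trans _ rg)//; near: q; apply: (cvgr_norm_le _ (@g_cont p)).
    by rewrite ltrDl.
  rewrite (le_trans _ rM)//.
  have Hq : forall al, M <= al -> 0 <= h q.2 ->
      `|halfspace_proj P (gradient h q.2) (al * h q.2) (f q)| <= M by near: q.
  apply: Hq; [exact: le_trans rM ral|exact: KS].
move=> [M [Mreal HM]].
pose M' := Num.max M 0 + 1.
have MM' : M < M' by rewrite ltr_pwDr// le_max lexx.
exists M'; first by rewrite addr_ge0// le_max lexx orbT.
by move=> q al Kq; apply: (HM _ MM').
Unshelve. all: by end_near. Qed.

Variables (Z : set 'rV[R]_m).
Hypothesis S_compact : compact (superlevel h).
Hypothesis Z_compact : compact Z.

Variables (alpha : nat -> R) (p0 : 'rV[R]_m * 'rV[R]_n) (T : R).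
Variables (phi_ : nat -> R -> 'rV[R]_m * 'rV[R]_n).
Hypothesis alpha_gt0 : forall i, 0 < alpha i.
Hypothesis alpha_infty : alpha i @[i --> \oo] --> +oo.
Hypothesis T_ge0 : 0 <= T.
Hypothesis phi_sol : forall i,
  solution (cbf_field h P f g (alpha i)) T p0 (phi_ i).
Hypothesis phi_in : forall i t, t \in `[0, T] -> (Z `*` superlevel h) (phi_ i t).

(** Freezes the trajectories outside [[0, T]], which gives functions on all of [R] with the same
    Lipschitz constant. *)
Let clip t : R := Num.max 0 (Num.min t T).

Let clip_itv t : 0 <= clip t <= T.
Proof.
by rewrite /clip le_max lexx/= ge_max T_ge0 ge_min lexx orbT.
Qed.

Let clipK t : 0 <= t <= T -> clip t = t.
Proof. by move=> /andP[t0 tT]; rewrite /clip min_l// max_r. Qed.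

Let clip_lip s t : `|clip s - clip t| <= `|s - t|.
Proof.
wlog st : s t / s <= t.
  by move=> H; have [|/ltW] := leP s t => /H//; rewrite distrC (distrC t).
rewrite distrC (distrC s) (ger0_norm (_ : 0 <= t - s)) ?subr_ge0// ler_norml.
have T0 := T_ge0; rewrite /clip; case: (leP s T) => ?; case: (leP t T) => ?;
  case: (leP 0 s) => ?; case: (leP 0 t) => ?; rewrite ?(max_r T0); lra.
Qed.

Lemma pds_subsequence : exists sigma : nat -> nat,
  {homo sigma : i j / (i < j)%N} /\
  exists2 phi, solution (pds_field h P f g) T p0 phi &
    forall e, 0 < e -> exists N, forall k, (N <= k)%N ->
      forall t, 0 <= t <= T -> `|phi_ (sigma k) t - phi t| <= e.
Proof.
have Kc : compact (Z `*` superlevel h) by exact: compact_setX.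
have [M M0 HM] := cbf_bounded Kc (fun q (Kq : (Z `*` superlevel h) q) => Kq.2).
(* From [I0] on, [alpha i] is past the threshold of [cbf_bounded], so the trajectories share the
   Lipschitz constant [M]. *)
have [I0 _ HI0] : \forall i \near \oo, M <= alpha i by exact: (cvgry_ge alpha_infty).
have de i : {ae lebesgue_measure, forall t : R, t \in `[0, T] ->
    derivable (phi_ i) t 1 /\ derive1 (phi_ i) t = (g (phi_ i t),
      halfspace_proj P (gradient h (phi_ i t).2) (alpha i * h (phi_ i t).2)
        (f (phi_ i t)))}.
  have [_ _] := phi_sol i; apply: aeS => t Ht tT; have [dt ->] := Ht tT.
  split => //; rewrite f_cbfE//; last exact: ltW.
  by have [] := phi_in i tT.
pose chi i t := phi_ (i + I0)%N (clip t).
have phi_lip i s t : (I0 <= i)%N -> 0 <= s <= T -> 0 <= t <= T ->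
    `|phi_ i s - phi_ i t| <= M * `|s - t|.
  move=> iI; wlog st : s t / s <= t.
    move=> H sT tT; have [|/ltW] := leP s t => st; first exact: H.
    by rewrite distrC (distrC s); exact: H.
  move=> /andP[s0 sT] /andP[t0 tT].
  rewrite distrC (distrC s) (ger0_norm (_ : 0 <= t - s)) ?subr_ge0//.
  rewrite -[X in `|X|]subr0 -[X in _ - X](scaler0 _ (t - s)).
  apply: (@abs_continuous_mean _ _ _ (fun x => `|x|) id _ _ _ 1) => //.
  - exact: ler_normD.
  - by move=> k x k0; rewrite normrZ ger0_norm.
  - by move=> x; rewrite mul1r.
  - by have [_ ac _] := phi_sol i; exact: abs_continuousS ac.
  apply: aeS (de i) => r Hr; rewrite in_itv/= => /andP[sr rt].
  have rT : r \in `[0, T] by rewrite in_itv/= (le_trans s0)// (le_trans rt).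
  have [dr ->] := Hr rT; split => //; rewrite subr0.
  by apply: HM; [exact: phi_in|exact: HI0].
have [||sigma [psi [sigma_lt psi_K psi_lip cvpsi]]] :=
    @lipschitz_subsequence _ _ _ T M chi Kc.
- by move=> i t; apply: phi_in; rewrite in_itv/=.
- move=> i s t; rewrite /chi (le_trans (phi_lip _ _ _ _ _ _))// ?leq_addl//.
  by rewrite ler_wpM2l.
have conv e : 0 < e -> exists N, forall k, (N <= k)%N ->
    forall t, 0 <= t <= T -> `|phi_ (sigma k + I0)%N t - psi t| <= e.
  move=> e0; have [N HN] := cvpsi _ e0; exists N => k Nk t tT.
  by have := HN k Nk t tT; rewrite /chi clipK.
have sigma_ge k : (k <= sigma k)%N.
  by elim: k => // k IH; rewrite (leq_ltn_trans IH)// sigma_lt.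
exists (fun k => sigma k + I0)%N; split.
  by move=> i j ij; rewrite ltn_add2r sigma_lt.
exists psi => //; split.
- apply/eqP; rewrite -subr_eq0 -normr_le0; apply/ler_addgt0Pl => e e0.
  rewrite addr0; have [N /(_ _ (leqnn _) 0)] := conv _ e0.
  rewrite lexx T_ge0 => /(_ isT); have [-> _ _] := phi_sol (sigma N + I0)%N.
  by rewrite distrC.
- exact: lipschitz_abs_continuous psi_lip.
- apply: (@limit_is_solution _ _ _ h P f g h_diff h_C1 grad_neq0 P_posdef f_cont
    g_cont (fun k => alpha (sigma k + I0)%N) T M (fun k => phi_ (sigma k + I0)%N)).
  + by move=> i; exact: ltW.
  + apply/cvgryPge => A; have [N _ HN] : \forall i \near \oo, A <= alpha i.
      exact: (cvgry_ge alpha_infty).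
    exists N => // k /= Nk; apply: HN => /=.
    by rewrite (leq_trans Nk)// (leq_trans (sigma_ge k))// leq_addr.
  + by move=> i; have [_] := phi_sol (sigma i + I0)%N.
  + by move=> i; exact: de.
  + by move=> i t tT; have [] := @phi_in (sigma i + I0)%N t tT.
  + exact: M0.
  + exact: psi_lip.
  + by move=> t; have [] := psi_K t.
  + exact: conv.
Qed.

End Subsequence.

(** * Uniqueness *)

Section OneSidedLipschitz.
Context {R : realType} {n : nat}.
Implicit Types (u v x y z : 'rV[R]_n).

Lemma sqr_norm_row_le u D : 0 <= D -> (forall j, u 0 j ^+ 2 <= D) -> `|u| ^+ 2 <= D.
Proof.
move=> D0 uD; rewrite -(sqr_sqrtr D0) ler_sqr ?nnegrE ?sqrtr_ge0//.
apply: normr_row_le => [|j]; first exact: sqrtr_ge0.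
by rewrite -sqrtr_sqr ler_wsqrtr.
Qed.

Lemma sqr_norm_le_dotv u : `|u| ^+ 2 <= dotv u u.
Proof.
apply: sqr_norm_row_le => [|j]; first exact: dotvv_ge0.
rewrite dotvE (bigD1 j)//= -expr2 lerDl sumr_ge0// => i _.
by rewrite -expr2 sqr_ge0.
Qed.

Variable P : 'M[R]_n.
Hypothesis P_posdef : posdef P.

Lemma pformDr u v x : pform P x (u + v) = pform P x u + pform P x v.
Proof. exact: dotvDr. Qed.

Lemma pformZr k u x : pform P x (k *: u) = k * pform P x u.
Proof. exact: dotvZr. Qed.

Lemma pformZl k u x : pform P (k *: u) x = k * pform P u x.
Proof. by rewrite pformC// pformZr pformC. Qed.

Lemma pformDl u v x : pform P (u + v) x = pform P u x + pform P v x.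
Proof. by rewrite pformC// pformDr !(pformC x). Qed.

Lemma pform_cauchy_schwarz u x :
  pform P u x ^+ 2 <= pform P u u * pform P x x.
Proof.
have [->|/(pform_gt0 P_posdef) x0] := eqVneq x 0.
  by rewrite /pform !dotv0r expr0n mulr0.
have := pform_ge0 (u + - (pform P u x / pform P x x) *: x) P_posdef.
rewrite pform_sqrD// pformZr !pformZl (pformC x u P_posdef).
set a := pform P u u; set b := pform P u x; set c := pform P x x in x0 *.
have E : a + 2 * (- (b / c) * b) + - (b / c) * (- (b / c) * c) = a - b ^+ 2 / c.
  by field; rewrite gt_eqF.
by rewrite E subr_ge0 ler_pdivrMr.
Qed.

(** The coordinate [x 0 j] is the [P]-product of [x] with [e j], so the Cauchy-Schwarz inequality
    bounds it. *)
Lemma sqr_norm_le_pform : exists2 C, 0 <= C &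
  forall x, `|x| ^+ 2 <= C * pform P x x.
Proof.
pose e j : 'rV[R]_n := delta_mx 0 j *m invmx P.
have e0 j : 0 <= pform P (e j) (e j) by exact: pform_ge0.
exists (\sum_j pform P (e j) (e j)) => [|x]; first by rewrite sumr_ge0.
have x0 : 0 <= pform P x x by exact: pform_ge0.
apply: sqr_norm_row_le => [|j]; first by rewrite mulr_ge0// sumr_ge0.
rewrite -dotv_delta dotvC -(pform_invmx _ _ P_posdef).
rewrite (le_trans (pform_cauchy_schwarz _ _))// ler_wpM2r//.
by rewrite (bigD1 j)//= lerDl sumr_ge0.
Qed.

Lemma pform_bounded : exists2 C, 0 <= C &
  forall u v, `|pform P u v| <= C * `|u| * `|v|.
Proof.
have [C C0 HC] := mulmx_bounded P.
exists (n%:R * C) => [|u v]; first by rewrite mulr_ge0.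
rewrite (le_trans (dotv_le _ _))// ler_wpM2r// -mulrA ler_wpM2l//.
Qed.

Variable h : 'rV[R]_n -> R.
Hypothesis h_diff : forall x, differentiable h x.
Hypothesis grad_lip : [locally [lipschitz (gradient h) x | x in setT]].

Lemma mean_value_gradient y z : exists2 c, 0 <= c <= 1 &
  h z - h y = dotv (gradient h (y + c *: (z - y))) (z - y).
Proof.
pose phi (s : R) := h (y + s *: (z - y)).
have dphi s : derivable phi s 1 /\
    derive1 phi s = dotv (gradient h (y + s *: (z - y))) (z - y).
  apply: expansion_derivable => e e0.
  have zy1 : 0 < `|z - y| + 1 by rewrite ltr_wpDl.
  have [|d d0 H] := gradient_expansion h_diff (y + s *: (z - y))
    (e := e / (`|z - y| + 1)); first by rewrite divr_gt0.
  exists (d / (`|z - y| + 1)) => [|s']; first by rewrite divr_gt0.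
  rewrite ltr_pdivlMr// => ss'.
  have E : y + s' *: (z - y) - (y + s *: (z - y)) = (s' - s) *: (z - y).
    by rewrite opprD addrACA subrr add0r -scalerBl.
  have st0 := normr_ge0 (s' - s); have zy0 := normr_ge0 (z - y).
  have := H (y + s' *: (z - y)); rewrite E dotvZr normrZ => /(_ _)/le_trans; apply.
    by nra.
  rewrite mulrCA [leRHS]mulrC ler_wpM2l//.
  rewrite mulrAC ler_pdivrMr// ler_wpM2l// ?ltW//; lra.
have [|s _||c] := @MVT_segment R phi
    (fun s => dotv (gradient h (y + s *: (z - y))) (z - y)) 0 1.
- exact: ler01.
- have [d1 d2] := dphi s; apply: DeriveDef => //; by rewrite -derive1E.
- by apply: derivable_within_continuous => s _; have [] := dphi s.
rewrite in_itv/= => c01; rewrite subr0 mulr1 => E; exists c => //.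
by rewrite -E /phi scale1r scale0r addr0 [y + (z - y)]addrC subrK.
Qed.

(* The superlevel set has a C^{1,1} boundary, hence positive reach; this
   replaces the monotonicity of normal cones available for convex sets. *)
Lemma gradient_one_sided x : exists2 C, 0 <= C & exists2 d, 0 < d &
  forall y z, ball x d y -> ball x d z -> h y = 0 -> 0 <= h z ->
    dotv (gradient h y) (y - z) <= C * `|y - z| ^+ 2.
Proof.
have [k k0 [d d0 H]] := locally_lipschitz_near x grad_lip.
exists (n%:R * k); first by rewrite mulr_ge0// ltW.
exists d => // y z xy xz hy hz.
have [c /andP[c0 c1]] := mean_value_gradient y z; rewrite hy subr0 => E.
have xw : ball x d (y + c *: (z - y)).
  move: xy xz; rewrite -ball_normE/= => xy xz.
  have -> : x - (y + c *: (z - y)) = (1 - c) *: (x - y) + c *: (x - z).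
    have -> : z - y = (x - y) - (x - z) by rewrite opprB [RHS]addrC subrKA.
    by rewrite scalerBl scale1r scalerBr !opprD opprK !addrA.
  rewrite (le_lt_trans (ler_normD _ _))// !normrZ !ger0_norm ?subr_ge0//.
  set a := `|x - y| in xy *; set b := `|x - z| in xz *.
  have mlt : Num.max a b < d by rewrite gt_max xy.
  have am : 0 <= (1 - c) * (Num.max a b - a) by rewrite mulr_ge0 ?subr_ge0 ?le_max ?lexx.
  have bm : 0 <= c * (Num.max a b - b) by rewrite mulr_ge0 ?subr_ge0 ?le_max ?lexx ?orbT.
  by lra.
have Hg := H _ _ xw xy.
have D := dotv_le (gradient h (y + c *: (z - y)) - gradient h y) (z - y).
have Lw : `|y + c *: (z - y) - y| <= `|z - y|.
  by rewrite [y + _]addrC addrK normrZ ger0_norm// ler_piMl.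
have -> : dotv (gradient h y) (y - z) = - dotv (gradient h y) (z - y).
  by rewrite -dotvNr opprB.
rewrite (distrC y z).
have Hle : dotv (gradient h (y + c *: (z - y)) - gradient h y) (z - y) <=
    n%:R * k * `|z - y| ^+ 2.
  apply: le_trans (ler_norm _) _; apply: (le_trans D).
  rewrite expr2 mulrA ler_wpM2r// -mulrA ler_wpM2l//.
  by rewrite (le_trans Hg)// ler_wpM2l// ltW.
apply: le_trans Hle.
(* By the mean value equation [E], the two sides differ by [h z], which is nonnegative. *)
have -> := etrans (dotvBl _ _ _) (congr1 (fun r => r - _) (esym E)).
by rewrite lerDr.
Qed.

End OneSidedLipschitz.

(** * The energy of a difference of solutions *)

Section Energy.
Context {R : realType} {m n : nat}.
Variable P : 'M[R]_n.
Hypothesis P_posdef : posdef P.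
Implicit Types (p q : 'rV[R]_m * 'rV[R]_n).

(** The inner product of the Gronwall estimate. Using [P] on the second component turns a correction
    along [gradient h *m invmx P] into a Euclidean product with the gradient. *)
Definition energy p q := dotv p.1 q.1 + pform P p.2 q.2.

Lemma energyDr p q q' : energy p (q + q') = energy p q + energy p q'.
Proof. by rewrite /energy dotvDr pformDr addrACA. Qed.

Lemma energyZr k p q : energy p (k *: q) = k * energy p q.
Proof. by rewrite /energy dotvZr pformZr mulrDr. Qed.

Lemma energyC p q : energy p q = energy q p.
Proof. by rewrite /energy dotvC pformC. Qed.

Lemma energyDl p p' q : energy (p + p') q = energy p q + energy p' q.
Proof. by rewrite energyC energyDr !(energyC q). Qed.

Lemma energyZl k p q : energy (k *: p) q = k * energy p q.
Proof. by rewrite energyC energyZr energyC. Qed.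

Lemma energyBB p q : energy p p - energy q q = energy (p + q) (p - q).
Proof.
have -> : p - q = p + (-1) *: q by rewrite scaleN1r.
by rewrite energyDr energyZr !energyDl (energyC q p); ring.
Qed.

Lemma energy_bounded : exists2 K, 0 <= K &
  forall p q, `|energy p q| <= K * `|p| * `|q|.
Proof.
have [C C0 HC] := pform_bounded P.
exists (m%:R + C) => [|p q]; first by rewrite addr_ge0.
have p1 : `|p.1| <= `|p| by rewrite prod_normE le_max lexx.
have p2 : `|p.2| <= `|p| by rewrite prod_normE le_max lexx orbT.
have q1 : `|q.1| <= `|q| by rewrite prod_normE le_max lexx.
have q2 : `|q.2| <= `|q| by rewrite prod_normE le_max lexx orbT.
rewrite (le_trans (ler_normD _ _))// !mulrDl lerD//.
  by rewrite (le_trans (dotv_le _ _))// ler_pM ?mulr_ge0// ler_wpM2l.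
by rewrite (le_trans (HC _ _))// ler_pM ?mulr_ge0// ler_wpM2l.
Qed.

Lemma sqr_norm_le_energy : exists2 C, 0 <= C &
  forall p, `|p| ^+ 2 <= C * energy p p.
Proof.
have [C C0 HC] := sqr_norm_le_pform P_posdef.
exists (1 + C) => [|p]; first by rewrite addr_ge0.
have h1 := sqr_norm_le_dotv p.1; have h2 := HC p.2.
have h3 := dotvv_ge0 p.1; have h4 := pform_ge0 p.2 P_posdef.
have h5 := mulr_ge0 C0 h3; have h6 := mulr_ge0 C0 h4.
by rewrite prod_normE /energy; case: (leP `|p.1| `|p.2|) => _; lra.
Qed.

(** The chain rule for the square of [delta], by the gauge argument. By [energyBB] an increment of
    the energy is the product of [delta u + delta s], close to [2 *: delta t], with
    [delta u - delta s], close to [(u - s) *: v]. *)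
Lemma energy_mean (delta : R -> 'rV[R]_m * 'rV[R]_n) a b c r :
  a <= b -> 0 <= r -> abs_continuous a b delta ->
  (forall t, a <= t <= b -> `|delta t| <= r) ->
  {ae lebesgue_measure, forall t : R, t \in `[a, b] ->
    derivable delta t 1 /\ 2 * energy (delta t) (derive1 delta t) <= c} ->
  energy (delta b) (delta b) - energy (delta a) (delta a) <= c * (b - a).
Proof.
move=> ab r0 ac bd dd; rewrite -subr_le0.
have [K K0 HK] := energy_bounded.
pose E t := energy (delta t) (delta t).
apply: (abs_continuous_interval (K := K * (r + r) + `|c|) (Phi := fun s u =>
  E u - E s - c * (u - s)) ab _ ac).
- by rewrite !addr_ge0// !mulr_ge0// addr_ge0.
- by move=> s t u *; rewrite /E; lra.
- move=> s u as_ su ub; rewrite /E energyBB.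
  have := HK (delta u + delta s) (delta u - delta s).
  have us : `|delta u + delta s| <= r + r.
    rewrite (le_trans (ler_normD _ _))// lerD// bd//.
      by rewrite (le_trans as_ su).
    by rewrite as_ (le_trans su ub).
  have : K * `|delta u + delta s| * `|delta u - delta s| <=
      K * (r + r) * `|delta u - delta s|.
    by rewrite ler_wpM2r// ler_wpM2l.
  have := ler_norm (energy (delta u + delta s) (delta u - delta s)).
  have : - c * (u - s) <= `|c| * (u - s).
    by rewrite ler_wpM2r ?subr_ge0// -normrN ler_norm.
  have : 0 <= `|c| * `|delta u - delta s| by rewrite mulr_ge0.
  have : 0 <= K * (r + r) * (u - s).
    by apply: mulr_ge0; [rewrite mulr_ge0 ?addr_ge0|rewrite subr_ge0].
  by lra.
apply: aeS dd => t dt tab e e0; have [dv lec] := dt tab.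
set v := derive1 delta t in lec *.
have K1 : 0 < K * (r + r) + K * `|v| + 1.
  by rewrite ltr_wpDl// addr_ge0// !mulr_ge0// addr_ge0.
(* [K * (r + r)] pays for the error on the difference, [K * |v|] for the error on the sum. *)
pose e1 := e / (K * (r + r) + K * `|v| + 1).
have e10 : 0 < e1 by rewrite divr_gt0.
have [d1 d10 H1] := derivable_straddle dv e10.
have [|d2 d20 H2] := derivable_expansion dv (e := 1); first exact: ltr01.
(* Within [d2] of [t], [delta] moves from [delta t] with slope at most [1 + |v|], so the last bound
   keeps the displacement below [e1 / 2]. *)
pose d := Num.min (Num.min d1 d2) (e1 / (2 * (1 + `|v|))).
have v1 : 0 < 1 + `|v| by rewrite ltr_pwDl.
exists d; first by rewrite !lt_min d10 d20 divr_gt0// mulr_gt0.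
move=> s u as_ st tu ub; rewrite !lt_min => /andP[/andP[us1 us2] us3].
have us0 : 0 <= u - s by rewrite subr_ge0 (le_trans st).
have near_t x : `|x - t| <= u - s -> `|delta x - delta t| <= e1 / 2.
  move=> xt; have := H2 x (le_lt_trans xt us2); rewrite -/v mul1r => Hx.
  have -> : delta x - delta t = (delta x - delta t - (x - t) *: v) + (x - t) *: v.
    by rewrite subrK.
  rewrite (le_trans (ler_normD _ _))// normrZ.
  move: us3; rewrite ltr_pdivlMr ?mulr_gt0// => us3.
  have := normr_ge0 v; have := normr_ge0 (x - t); nra.
have nu : `|delta u - delta t| <= e1 / 2.
  by apply: near_t; rewrite ger0_norm ?subr_ge0// lerD2l lerN2.
have ns : `|delta s - delta t| <= e1 / 2.
  by apply: near_t; rewrite distrC ger0_norm ?subr_ge0// lerD2r.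
rewrite /E energyBB.
set x := delta u + delta s.
have -> : delta u - delta s = (delta u - delta s - (u - s) *: v) + (u - s) *: v.
  by rewrite subrK.
have rest := H1 s u st tu us1; rewrite -/v in rest.
set y := delta u - delta s - (u - s) *: v in rest *.
have xr : `|x| <= r + r.
  rewrite (le_trans (ler_normD _ _))// lerD// bd//.
    by rewrite (le_trans as_ (le_trans st tu)).
  by rewrite as_ (le_trans st (le_trans tu ub)).
have x2 : `|x - 2 *: delta t| <= e1.
  have -> : x - 2 *: delta t = (delta u - delta t) + (delta s - delta t).
    by rewrite /x scaler_nat mulr2n opprD addrACA.
  by rewrite (le_trans (ler_normD _ _))//; lra.
have -> : x = 2 *: delta t + (x - 2 *: delta t) by rewrite addrC subrK.
set z := x - 2 *: delta t in x2 *.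
have Exy : energy (2 *: delta t + z) y <= K * (r + r) * (e1 * (u - s)).
  have -> : 2 *: delta t + z = x by rewrite /z addrC subrK.
  apply: le_trans (ler_norm _) _; rewrite (le_trans (HK _ _))//.
  by rewrite ler_pM ?mulr_ge0// ler_wpM2l.
have Ezv : energy z v <= K * e1 * `|v|.
  apply: le_trans (ler_norm _) _; rewrite (le_trans (HK _ _))//.
  by rewrite ler_wpM2r// ler_wpM2l.
rewrite energyDr energyZr [energy _ v]energyDl energyZl.
have : (u - s) * (2 * energy (delta t) v + energy z v) <=
    (u - s) * (c + K * e1 * `|v|) by rewrite ler_wpM2l// lerD.
have Ee : e1 * (K * (r + r) + K * `|v| + 1) = e by rewrite divfK// gt_eqF.
have e1u : 0 <= e1 * (u - s) by rewrite mulr_ge0// ltW.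
have <- : e1 * (u - s) * (K * (r + r) + K * `|v| + 1) = e * (u - s).
  by rewrite mulrAC Ee.
by lra.
Qed.

End Energy.

Section Uniqueness.
Context {R : realType} {m n : nat}.

Lemma abs_continuousB {V : normedModType R} (phi psi : R -> V) a b :
  abs_continuous a b phi -> abs_continuous a b psi ->
  abs_continuous a b (phi \- psi).
Proof.
move=> ac1 ac2 e e0; have e20 : 0 < e / 2 by rewrite divr_gt0.
have [d1 d10 H1] := ac1 _ e20; have [d2 d20 H2] := ac2 _ e20.
exists (Num.min d1 d2) => [|N s t st tr]; first by rewrite lt_min d10.
rewrite lt_min => /andP[/(H1 _ _ _ st tr) h1 /(H2 _ _ _ st tr) h2].
apply: (@le_lt_trans _ _ (\sum_(i < N) (`|phi (t i) - phi (s i)| +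
    `|psi (t i) - psi (s i)|))); last by rewrite big_split/=; lra.
by apply: ler_sum => i _; rewrite /= opprD addrACA -opprD; exact: ler_normB.
Qed.

Lemma derive1_sub {V : normedModType R} (phi psi : R -> V) t :
  derivable phi t 1 -> derivable psi t 1 -> derivable (phi \- psi) t 1 /\
  derive1 (phi \- psi) t = derive1 phi t - derive1 psi t.
Proof.
move=> dphi dpsi; split; first exact: derivableB.
by rewrite !derive1E; exact: deriveB.
Qed.

Lemma abs_continuous_uniform {V : normedModType R} (phi : R -> V) a b e :
  abs_continuous a b phi -> 0 < e -> exists2 d, 0 < d &
    forall s t, a <= s <= b -> a <= t <= b -> `|s - t| < d ->
      `|phi s - phi t| < e.
Proof.
move=> ac e0; have [d d0 H] := ac e e0; exists d => // s t.
wlog st : s t / s <= t.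
  move=> W sab tab; have [|/ltW] := leP s t; first by move=> st; exact: W.
  by move=> ts; rewrite distrC (distrC (phi s)); exact: W.
move=> /andP[as_ sb] /andP[at_ tb]; rewrite distrC ger0_norm ?subr_ge0// => std.
have := H 1%N (fun=> s) (fun=> t); rewrite !big_ord1 distrC; apply => //.
by apply/trivIsetP => i j _ _; rewrite !ord1 eqxx.
Qed.

Variables (h : 'rV[R]_n -> R) (P : 'M[R]_n).
Variables (f : 'rV[R]_m * 'rV[R]_n -> 'rV[R]_n).
Variables (g : 'rV[R]_m * 'rV[R]_n -> 'rV[R]_m).
Hypothesis h_diff : forall x, differentiable h x.
Hypothesis grad_neq0 : forall x, h x = 0 -> gradient h x != 0.
Hypothesis P_posdef : posdef P.
Hypothesis grad_lip : [locally [lipschitz (gradient h) x | x in setT]].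
Hypothesis f_lip : [locally [lipschitz f p | p in setT]].
Hypothesis g_lip : [locally [lipschitz g p | p in setT]].

Let h_C1 : continuous (gradient h) := locally_lipschitz_continuous grad_lip.
Let f_cont : continuous f := locally_lipschitz_continuous f_lip.

(** The quantity is the coefficient of [gradient h q.2 *m invmx P] in the correction term. If
    [h p.2 = 0], both factors are bounded near [p], the gradient being nonzero; otherwise no nearby
    [q] satisfies [h q.2 = 0]. *)
Lemma multiplier_near_bounded (p : 'rV[R]_m * 'rV[R]_n) :
  exists2 B, 0 <= B & \forall q \near p,
  h q.2 = 0 ->
  - Num.min 0 (lie f h q + 0) *
    (dotv (gradient h q.2) (gradient h q.2 *m invmx P))^-1 <= B.
Proof.
have [hp|hp] := eqVneq (h p.2) 0; last first.
  exists 0 => //; near=> q; move=> hq; exfalso.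
  have : `|h q.2 - h p.2| < `|h p.2|.
    near: q; apply: cvgr_distC_lt; first exact: (@cvg_h _ _ _ _ h_diff p).
    by rewrite normr_gt0.
  by rewrite hq sub0r normrN ltxx.
have a0 := grad_neq0 hp.
pose D := dotv (gradient h p.2) (gradient h p.2 *m invmx P).
have cD : (dotv (gradient h q.2) (gradient h q.2 *m invmx P))^-1 @[q --> p] --> D^-1.
  apply: cvgV; first by rewrite gt_eqF// dotv_invmx_gt0.
  apply: cvg_dotv; first exact: cvg_gradient.
  exact: cvg_comp (@cvg_gradient _ _ _ _ h_C1 p) (@mulmx_continuous _ _ (invmx P) _).
exists ((`|lie f h p| + 1) * (`|D^-1| + 1)); first by rewrite mulr_ge0// addr_ge0.
near=> q; move=> hq; have aq := grad_neq0 hq.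
apply: ler_pM.
- by rewrite oppr_ge0 ge_min lexx.
- by rewrite invr_ge0 ltW// dotv_invmx_gt0.
- apply: (@le_trans _ _ `|lie f h q|).
    rewrite addr0 lerNl le_min lerNl oppr0 normr_ge0/= lerNl.
    by rewrite -normrN ler_norm.
  near: q; apply: (cvgr_norm_le _ (@cvg_lie _ _ _ _ _ h_C1 f_cont p)).
  by rewrite ltrDl.
- apply: le_trans (ler_norm _) _.
  by near: q; apply: (cvgr_norm_le _ cD); rewrite ltrDl.
Unshelve. all: by end_near. Qed.

Let correction q : 'rV[R]_n :=
  - Num.min 0 (dotv (active_normal h q.2) (f q) + 0) *:
    pnormal P (active_normal h q.2).

(** [pform P] cancels [invmx P], which leaves a bounded nonnegative multiple of the product
    estimated in [gradient_one_sided]. *)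
Lemma correction_one_sided (p : 'rV[R]_m * 'rV[R]_n) :
  exists2 C, 0 <= C & exists2 r, 0 < r &
  forall q1 q2, ball p r q1 -> ball p r q2 -> 0 <= h q2.2 ->
  pform P (correction q1) (q1.2 - q2.2) <= C * `|q1 - q2| ^+ 2.
Proof.
have [B B0 /nbhs_ballP[r1 /= r10 HB]] := multiplier_near_bounded p.
have [C C0 [r2 r20 HC]] := gradient_one_sided h_diff grad_lip p.2.
exists (B * C); first by rewrite mulr_ge0.
exists (Num.min r1 r2) => [|q1 q2]; first by rewrite lt_min r10.
rewrite -ball_normE/= !lt_min => /andP[pq1 pq1'] /andP[_ pq2'] hq2.
have n2 (x : 'rV[R]_m * 'rV[R]_n) : `|x.2| <= `|x|.
  by rewrite prod_normE le_max lexx orbT.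
rewrite /correction /active_normal; have [hq1|hq1] := eqVneq (h q1.2) 0; last first.
  rewrite /pnormal mul0mx !scaler0 /pform mul0mx dotv0l.
  by rewrite mulr_ge0 ?sqr_ge0// mulr_ge0.
rewrite /pnormal scalerA pformZl// pform_invmx//.
have HB1 : - Num.min 0 (lie f h q1 + 0) *
    (dotv (gradient h q1.2) (gradient h q1.2 *m invmx P))^-1 <= B.
  by apply: HB => //; rewrite -ball_normE.
have HC1 : dotv (gradient h q1.2) (q1.2 - q2.2) <= C * `|q1 - q2| ^+ 2.
  apply: (@le_trans _ _ (C * `|q1.2 - q2.2| ^+ 2)).
    by apply: HC => //; rewrite -ball_normE/=; exact: le_lt_trans (n2 (_ - _)) _.
  by rewrite ler_wpM2l// lerXn2r ?nnegrE//; exact: (n2 (q1 - q2)).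
set c := - _ * _ in HB1 *.
have c0 : 0 <= c.
  rewrite mulr_ge0//; first by rewrite oppr_ge0 ge_min lexx.
  by rewrite invr_ge0 ltW// dotv_invmx_gt0// grad_neq0.
apply: (@le_trans _ _ (c * (C * `|q1 - q2| ^+ 2))); first by rewrite ler_wpM2l.
by rewrite -mulrA ler_wpM2r// mulr_ge0// sqr_ge0.
Qed.

(** [f] and [g] contribute Lipschitz terms, and each of the two corrections a one-sided term, with
    the roles of [q1] and [q2] exchanged. *)
Lemma pds_field_one_sided (p : 'rV[R]_m * 'rV[R]_n) :
  exists2 C, 0 <= C & exists2 r, 0 < r &
  forall q1 q2 v1 v2, ball p r q1 -> ball p r q2 ->
  pds_field h P f g q1 v1 -> pds_field h P f g q2 v2 ->
  energy P (q1 - q2) (v1 - v2) <= C * energy P (q1 - q2) (q1 - q2).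
Proof.
have [kf kf0 [r1 r10 Hf]] := locally_lipschitz_near p f_lip.
have [kg kg0 [r2 r20 Hg]] := locally_lipschitz_near p g_lip.
have [C C0 [r3 r30 HC]] := correction_one_sided p.
have [K K0 HK] := @energy_bounded R m n P.
have [E E0 HE] := @sqr_norm_le_energy R m n P P_posdef.
have kk0 : 0 <= kg + kf by rewrite addr_ge0// ltW.
have KC0 : 0 <= K * (kg + kf) + C + C by rewrite !addr_ge0// mulr_ge0.
exists ((K * (kg + kf) + C + C) * E); first by rewrite mulr_ge0.
exists (Num.min r1 (Num.min r2 r3)); first by rewrite !lt_min r10 r20.
move=> q1 q2 v1 v2; rewrite -ball_normE/= !lt_min.
move=> /and3P[p11 p12 p13] /and3P[p21 p22 p23].
move=> /(pds_fieldP f h_diff grad_neq0 P_posdef)[h1 v11 v12].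
move=> /(pds_fieldP f h_diff grad_neq0 P_posdef)[h2 v21 v22].
pose F : 'rV[R]_m * 'rV[R]_n := (g q1 - g q2, f q1 - f q2).
have Fle : `|F| <= (kg + kf) * `|q1 - q2|.
  have q0 := normr_ge0 (q1 - q2).
  rewrite prod_normE ge_max; apply/andP; split => /=.
    rewrite (le_trans (Hg _ _ _ _)) -?ball_normE//=.
    by rewrite ler_wpM2r// lerDl ltW.
  rewrite (le_trans (Hf _ _ _ _)) -?ball_normE//=.
  by rewrite ler_wpM2r// lerDr ltW.
have v12' : v1.2 = f q1 + correction q1 by rewrite v12; exact: halfspace_projE.
have v22' : v2.2 = f q2 + correction q2 by rewrite v22; exact: halfspace_projE.
have c1 := HC q1 q2; have c2 := HC q2 q1.
rewrite -ball_normE/= in c1 c2.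
have {}c1 := c1 p13 p23 h2; have {}c2 := c2 p23 p13 h1.
rewrite (distrC q2) in c2.
move: (correction q1) (correction q2) v12' v22' c1 c2 => k1 k2 v12' v22' c1 c2.
have -> : energy P (q1 - q2) (v1 - v2) = energy P (q1 - q2) F +
    pform P k1 (q1.2 - q2.2) + pform P k2 (q2.2 - q1.2).
  have E1 : (v1 - v2).1 = F.1 by transitivity (v1.1 - v2.1); rewrite // v11 v21.
  have E2 : (v1 - v2).2 = F.2 + (k1 - k2).
    transitivity (v1.2 - v2.2) => //.
    by rewrite v12' v22' opprD addrACA.
  have Ed : pform P (q1 - q2).2 (k1 - k2) =
      pform P k1 (q1.2 - q2.2) + pform P k2 (q2.2 - q1.2).
    transitivity (pform P (q1.2 - q2.2) (k1 - k2)) => //.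
    rewrite pformC// pformDl// -(opprB q1.2 q2.2) -[- k2]scaleN1r.
    by rewrite -[- (_ - _)]scaleN1r pformZl// pformZr.
  by rewrite /energy E1 E2 pformDr Ed !addrA.
have := HE (q1 - q2) => HEq.
have e1 : energy P (q1 - q2) F <= K * (kg + kf) * `|q1 - q2| ^+ 2.
  apply: le_trans (ler_norm _) _; rewrite (le_trans (HK _ _))//.
  apply: (@le_trans _ _ (K * `|q1 - q2| * ((kg + kf) * `|q1 - q2|))).
    by rewrite ler_wpM2l// mulr_ge0.
  by rewrite expr2; lra.
rewrite -[leRHS]mulrA.
apply: (@le_trans _ _ ((K * (kg + kf) + C + C) * `|q1 - q2| ^+ 2)).
  by apply: (le_trans (lerD (lerD e1 c1) c2)); rewrite -!mulrDl.
by rewrite ler_wpM2l.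
Qed.

(** Gronwall by local propagation: the predicate given to [cousin] says that equality at [s] implies
    equality at [u], so only short intervals around each [t] have to be treated. *)
Lemma pds_unique T p0 psi1 psi2 :
  solution (pds_field h P f g) T p0 psi1 ->
  solution (pds_field h P f g) T p0 psi2 ->
  {in `[0, T], psi1 =1 psi2}.
Proof.
move=> [i1 ac1 de1] [i2 ac2 de2] t1; rewrite in_itv/= => /andP[t10 t1T].
suff : psi1 0 = psi2 0 -> psi1 t1 = psi2 t1 by apply; rewrite i1.
apply: (@cousin _ 0 t1 (fun s u => psi1 s = psi2 s -> psi1 u = psi2 u)) => //.
  by move=> s t u _ _ _ _ H1 H2 /H1.
move=> t /andP[t0 tt1].
have tT : 0 <= t <= T by rewrite t0 (le_trans tt1).
have [pp|pp] := eqVneq (psi1 t) (psi2 t); last first.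
  (* Solutions that differ at [t] differ nearby by continuity, so the premise at [s] fails. *)
  pose e := `|psi1 t - psi2 t| / 2.
  have e0 : 0 < e by rewrite divr_gt0// normr_gt0 subr_eq0.
  have [d1 d10 H1] := abs_continuous_uniform ac1 e0.
  have [d2 d20 H2] := abs_continuous_uniform ac2 e0.
  exists (Num.min d1 d2) => [|s u s0 st tu ut]; first by rewrite lt_min d10.
  rewrite lt_min => /andP[us1 us2] ss; exfalso.
  have sT : 0 <= s <= T by rewrite s0 (le_trans st)//; case/andP: tT.
  have := H1 s t sT tT; have := H2 s t sT tT.
  rewrite (distrC s) ger0_norm ?subr_ge0// => /(_ ltac:(lra)) h2 /(_ ltac:(lra)) h1.
  have : `|psi1 t - psi2 t| < e + e.
    have -> : psi1 t - psi2 t = (psi2 s - psi2 t) - (psi1 s - psi1 t).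
      by rewrite -ss opprB [RHS]addrC subrKA.
    by rewrite (le_lt_trans (ler_normB _ _))// ltrD.
  by rewrite /e; lra.
have [C C0 [r r0 HC]] := pds_field_one_sided (psi1 t).
have [d1 d10 H1] := abs_continuous_uniform ac1 r0.
have [d2 d20 H2] := abs_continuous_uniform ac2 r0.
have C1 : 0 < 4 * (C + 1) by rewrite mulr_gt0// ltr_wpDl.
(* The last bound gives [2 * C * (x - s) <= 1 / 2], so the energy is at most half of its supremum
   [B] on the interval, which forces [B = 0]. *)
exists (Num.min (Num.min d1 d2) (4 * (C + 1))^-1) => [|s u s0 st tu ut].
  by rewrite !lt_min d10 d20 invr_gt0.
rewrite !lt_min => /andP[/andP[us1 us2] us3] ss.
have su : s <= u := le_trans st tu.
have uT : u <= T := le_trans ut t1T.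
pose delta := psi1 \- psi2.
have near_t x : s <= x <= u -> ball (psi1 t) r (psi1 x) /\ ball (psi1 t) r (psi2 x).
  move=> /andP[sx xu]; have xT : 0 <= x <= T by rewrite (le_trans s0)// (le_trans xu).
  have xt : `|t - x| <= u - s by rewrite ler_norml; lra.
  rewrite -ball_normE/=; split; first by apply: H1 => //; exact: le_lt_trans us1.
  by rewrite pp; apply: H2 => //; exact: le_lt_trans us2.
have bd x : s <= x <= u -> `|delta x| <= r + r.
  move=> /near_t; rewrite -ball_normE/= => -[b1 b2].
  have -> : delta x = (psi1 t - psi2 x) - (psi1 t - psi1 x).
    by rewrite /delta/= opprB [RHS]addrC subrKA.
  by rewrite (le_trans (ler_normB _ _))// lerD// ltW.
have acd : abs_continuous 0 T delta by exact: abs_continuousB.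
pose E x := energy P (delta x) (delta x).
have [K K0 HK] := @energy_bounded R m n P.
pose A := [set E x | x in [set x | s <= x <= u]].
have A0 : A !=set0 by exists (E s); exists s => //=; rewrite lexx.
have Aub : has_ubound A.
  exists (K * (r + r) * (r + r)) => _ [x /= sxu <-].
  have bx := bd x sxu.
  apply: le_trans (ler_norm _) _; rewrite (le_trans (HK _ _))//.
  by rewrite ler_pM ?mulr_ge0// ler_wpM2l.
set B := sup A.
have EB x : s <= x <= u -> E x <= B by move=> sxu; apply: ub_le_sup => //; exists x.
have Es : E s = 0.
  by rewrite /E /energy /delta/= ss !subrr dotv0r /pform dotv0r addr0.
have B0 : 0 <= B by rewrite -Es EB// lexx.
have half x : s <= x <= u -> E x <= B / 2.
  move=> /andP[sx xu].
  have : E x - E s <= 2 * C * B * (x - s).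
    apply: (@energy_mean _ _ _ P P_posdef delta s x (2 * C * B) (r + r)) => //.
    - by rewrite addr_ge0// ltW.
    - by apply: abs_continuousS acd => //; exact: le_trans uT.
    - by move=> y /andP[sy yx]; apply: bd; rewrite sy (le_trans yx).
    apply: aeS (aeI de1 de2) => y [D1 D2]; rewrite in_itv/= => /andP[sy yx].
    have yT : y \in `[0, T].
      by rewrite in_itv/= (le_trans s0)// (le_trans yx)// (le_trans xu).
    have [dv1 F1] := D1 yT; have [dv2 F2] := D2 yT.
    have syu : s <= y <= u by rewrite sy (le_trans yx).
    have [b1 b2] := near_t y syu.
    have [dd dE] := derive1_sub dv1 dv2; split; first exact: dd.
    have -> : derive1 delta y = derive1 psi1 y - derive1 psi2 y by exact: dE.
    rewrite -mulrA; apply: ler_wpM2l; first exact: ler0n.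
    apply: (le_trans (HC _ _ _ _ b1 b2 F1 F2)); apply: ler_wpM2l; first exact: C0.
    exact: EB.
  rewrite Es subr0 => /le_trans; apply.
  have xs : (x - s) * (4 * (C + 1)) <= 1.
    have := ltW us3; rewrite -[_^-1]mul1r ler_pdivlMr// => /(le_trans _); apply.
    by apply: ler_wpM2r; [exact: ltW|rewrite lerD2r].
  have : 0 <= B * (x - s) by rewrite mulr_ge0// subr_ge0.
  have : B * ((x - s) * (4 * (C + 1))) <= B * 1 by rewrite ler_wpM2l.
  by lra.
have : B <= B / 2 by apply: ge_sup => // _ [x /= sxu <-]; exact: half.
move=> BB; have {BB}B00 : B <= 0 by lra.
have := EB u; rewrite su lexx => /(_ isT) Eu.
have [CE CE0 HCE] := @sqr_norm_le_energy R m n P P_posdef.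
have : `|delta u| ^+ 2 <= 0.
  apply: (le_trans (HCE _)).
  rewrite -[leRHS](mulr0 CE) ler_wpM2l//; exact: le_trans Eu B00.
rewrite le_eqVlt ltNge sqr_ge0 orbF sqrf_eq0 normr_eq0 subr_eq0.
by move=> /eqP.
Qed.

End Uniqueness.

(** * Convergence of the whole sequence *)

Section Convergence.
Context {R : realType} {V : normedModType R}.

Lemma uniform_cvg_itv (phi_ : nat -> R -> V) (phi : R -> V) T :
  (forall e, 0 < e -> exists N, forall i, (N <= i)%N ->
     forall t, 0 <= t <= T -> `|phi_ i t - phi t| <= e) ->
  forall a b, 0 <= a -> b < T ->
    {uniform `[a, b]%classic, phi_ i @[i --> \oo] --> phi}.
Proof.
move=> H a b a0 bT U /uniform_nbhs[E [entE EU]].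
move: entE; rewrite -entourage_ballE => -[e /= e0 eE].
have [|N HN] := H (e / 2); first by rewrite divr_gt0.
exists N => // i /= Ni; apply: EU => t /=; rewrite in_itv/= => /andP[at_ tb].
apply: eE; rewrite /= -ball_normE/= distrC.
apply: (le_lt_trans (HN i Ni t _)); last by rewrite ltr_pdivrMr// mulr_natr mulr2n ltrDl.
by rewrite (le_trans a0)//= (le_trans tb)// ltW.
Qed.

Lemma strictly_increasing_subsequence (Q : nat -> Prop) :
  (forall N, exists2 i, (N <= i)%N & Q i) ->
  exists2 tau : nat -> nat, {homo tau : i j / (i < j)%N} & forall k, Q (tau k).
Proof.
move=> H; have /choice[c cP] : forall N, exists i, (N <= i)%N /\ Q i.
  by move=> N; have [i] := H N; exists i.
pose tau := fix s k := if k is k'.+1 then c (s k').+1 else c 0%N.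
exists tau; last by case=> [|k]; [have [] := cP 0%N|have [] := cP (tau k).+1].
apply: homo_ltn; first exact: ltn_trans.
by move=> k; have [] := cP (tau k).+1.
Qed.

End Convergence.

Theorem mainTheorem1 (R : realType) (m n : nat)
  (h : 'rV[R]_n -> R) (L : R) (gamma : R -> R)
  (P : 'M[R]_n)
  (f : 'rV[R]_m * 'rV[R]_n -> 'rV[R]_n)
  (g : 'rV[R]_m * 'rV[R]_n -> 'rV[R]_m)
  (Z : set 'rV[R]_m) (eps : R)
  (alpha : nat -> R) (z0 : 'rV[R]_m) (x0 : 'rV[R]_n) (T : R)
  (phi_ : nat -> R -> 'rV[R]_m * 'rV[R]_n)
  (S_nonempty : superlevel h !=set0)
  (S_compact : compact (superlevel h))
  (h_diff : forall x, differentiable h x)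
  (h_C1 : continuous (gradient h))
  (grad_loc_lip : [locally [lipschitz (gradient h) x | x in setT]])
  (grad_lip : forall x y, superlevel h x -> superlevel h y ->
     enorm (gradient h x - gradient h y) <= L * enorm (x - y))
  (grad_neq0 : forall x, h x = 0 -> gradient h x != 0)
  (gamma_K : Kinfty gamma)
  (dist_gamma : forall x, superlevel h x ->
     dist_to x (boundary (superlevel h)) <= gamma (h x))
  (P_posdef : posdef P)
  (f_loc_lip : [locally [lipschitz f p | p in setT]])
  (Z_compact : compact Z)
  (eps_gt0 : 0 < eps)
  (eps_lt : eps < min_boundary_gradient h)
  (alpha_incr : nondecreasing_seq alpha)
  (alpha_gt0 : forall i, 0 < alpha i)
  (alpha_ge : forall i, alpha_star h f Z gamma L eps <= alpha i)
  (alpha_infty : alpha i @[i --> \oo] --> +oo)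
  (z0_in : Z z0) (x0_in : superlevel h x0)
  (T_ge0 : 0 <= T)
  (phi_sol : forall i,
     solution (cbf_field h P f g (alpha i)) T (z0, x0) (phi_ i))
  (phi_in : forall i t, t \in `[0, T] -> (Z `*` superlevel h) (phi_ i t))
  (g_cont : continuous g)
  (g_loc_bounded : [locally [bounded g p | p in setT]]) :
  (exists sigma : nat -> nat, {homo sigma : i j / (i < j)%N} /\
     exists2 phi : R -> 'rV[R]_m * 'rV[R]_n,
       solution (pds_field h P f g) T (z0, x0) phi &
       forall a b : R, 0 <= a -> a <= b -> b < T ->
         {uniform `[a, b]%classic, phi_ (sigma k) @[k --> \oo] --> phi})
  /\
  ([locally [lipschitz g p | p in setT]] ->
   exists phi : R -> 'rV[R]_m * 'rV[R]_n,
     [/\ solution (pds_field h P f g) T (z0, x0) phi,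
         forall psi, solution (pds_field h P f g) T (z0, x0) psi ->
           {in `[0, T], psi =1 phi} &
         forall a b : R, 0 <= a -> a <= b -> b < T ->
           {uniform `[a, b]%classic, phi_ i @[i --> \oo] --> phi}]).
Proof.
have f_cont := locally_lipschitz_continuous f_loc_lip.
(* Kept general in the parameters and trajectories: it serves for the given sequence and then for a
   subsequence of it. *)
have subseq (al : nat -> R) phi := @pds_subsequence R m n h P f g h_diff h_C1
  grad_neq0 P_posdef f_cont g_cont Z S_compact Z_compact al (z0, x0) T phi.
have [sigma [sigma_lt [phi phi_pds phi_cvg]]] :=
  subseq alpha phi_ alpha_gt0 alpha_infty T_ge0 phi_sol phi_in.
split.
  exists sigma; split => //; exists phi => // a b a0 _ bT.
  exact: (uniform_cvg_itv phi_cvg).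
move=> g_lip; exists phi.
have uniq psi : solution (pds_field h P f g) T (z0, x0) psi ->
    {in `[0, T], psi =1 phi}.
  move=> psi_pds.
  exact: (pds_unique h_diff grad_neq0 P_posdef grad_loc_lip f_loc_lip g_lip
    psi_pds phi_pds).
split => // a b a0 _ bT; apply: (uniform_cvg_itv (T := T)) => // e e0.
(* Otherwise a subsequence [tau] stays more than [e] away from [phi], at times that may depend on
   the index. It has a further subsequence converging to a PDS solution, which is [phi] by
   uniqueness. *)
apply: contrapT => /forallNP far.
have [|tau tau_lt tau_far] := @strictly_increasing_subsequence
    (fun i => exists2 t, 0 <= t <= T & e < `|phi_ i t - phi t|).
  move=> N; have /existsNP[i /not_implyP[Ni /existsNP[t /not_implyP[tT]]]] := far N.
  by move=> /negP; rewrite -ltNge => lt_e; exists i => //; exists t.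
have tau_ge k : (k <= tau k)%N.
  by elim: k => // k IH; rewrite (leq_ltn_trans IH)// tau_lt.
have al_tau : alpha (tau k) @[k --> \oo] --> +oo.
  apply/cvgryPge => A; have [N _ HN] : \forall i \near \oo, A <= alpha i.
    exact: (cvgry_ge alpha_infty).
  by exists N => // k /= Nk; apply: HN => /=; rewrite (leq_trans Nk).
have [s [_ [psi psi_pds psi_cvg]]] := subseq (alpha \o tau) (phi_ \o tau)
  (fun i => alpha_gt0 (tau i)) al_tau T_ge0 (fun i => phi_sol (tau i))
  (fun i => phi_in (tau i)).
have [N HN] := psi_cvg _ e0.
have [t tT lt_e] := tau_far (s N).
have := HN N (leqnn N) t tT; rewrite /= (uniq _ psi_pds) ?in_itv//.
by rewrite leNgt lt_e.
Qed.
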